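(* Let $q\ge r\ge 2$ be integers. On the Diestel--Leader graph $DL(q,r)$, the free uniform spanning forest is the same as the wired uniform spanning forest, i.e. the two measures $\mathrm{FUSF}$ and $\mathrm{WUSF}$ coincide.
   Context: For $b\ge2$ let $\mathbb{T}_{b+1}$ be the $(b+1)$-regular tree with a fixed root $o$ and a fixed end $\xi$. For each vertex $v$ let $\eta_v$ be the unique ray from $v$ representing $\xi$. For vertices $x,y$ let $x\curlywedge y$ be the first intersection vertex of $\eta_x$ and $\eta_y$. The Busemann function is $\mathfrak{h}(x)=d(o,x\curlywedge o)-d(x,x\curlywedge o)$, with $d$ the graph distance of the tree. Diestel--Leader graph $DL(q,r)$: fix roots $o_1,o_2$ and ends $\omega_1,\omega_2$ of $\mathbb{T}_{q+1}$ and $\mathbb{T}_{r+1}$, with corresponding Busemann functions (both denoted $\mathfrak{h}$). The vertices are the pairs $x_1x_2\in\mathbb{T}_{q+1}\times\mathbb{T}_{r+1}$ with $\mathfrak{h}(x_1)+\mathfrak{h}(x_2)=0$, and $x_1x_2\sim y_1y_2$ if and only if $x_1\sim y_1$ and $x_2\sim y_2$. WUSF and FUSF on an infinite, locally finite, connected graph $G$: for an exhaustion of $G$ by finite connected induced subgraphs $G_n$, FUSF is the weak limit of the uniform spanning tree measures on $G_n$, and WUSF is the weak limit of the uniform spanning tree measures on $G_n^W$, the graph obtained from $G$ by identifying all vertices outside $G_n$ to one vertex and deleting loops (keeping multiple edges). *)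

(* Defs.v *)
From HB Require Import structures.
From mathcomp Require Import all_boot all_order all_algebra finmap.
From mathcomp Require Import all_classical all_reals all_analysis.

Set Implicit Arguments.
Unset Strict Implicit.
Unset Printing Implicit Defensive.
Import Order.TTheory GRing.Theory Num.Theory.
Import numFieldNormedType.Exports.

Local Open Scope classical_set_scope.
Local Open Scope ring_scope.

Record sgraph := SGraph {
  vertex :> choiceType;
  adj : rel vertex;
  adj_sym : symmetric adj;
  adj_irr : irreflexive adj }.

Definition gconnected (G : sgraph) : Prop :=
  forall x y : G, exists p : seq G, path (@adj G) x p /\ last x p = y.

(* [cycle] accepts [:: x; y] as soon as x ~ y, hence the size condition. *)
Definition gacyclic (G : sgraph) : Prop :=
  forall c : seq G, (2 < size c)%N -> ~ ucycle (@adj G) c.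

Definition is_tree (G : sgraph) : Prop := gconnected G /\ gacyclic G.

Definition regular (d : nat) (G : sgraph) : Prop :=
  forall x : G, ([set y | adj x y] #= `I_d)%card.

(* The least element of P, and 0 if P is empty. *)
Definition least (P : set nat) : nat :=
  xget 0%N [set n | P n /\ forall m, P m -> (n <= m)%N].

Definition gdist (G : sgraph) (x y : G) : nat :=
  least [set n | exists p : seq G,
    [/\ path (@adj G) x p, last x p = y & size p = n]].

Definition is_ray (G : sgraph) (r : nat -> G) : Prop :=
  injective r /\ forall n, adj (r n) (r n.+1).

Definition tail_equiv (G : sgraph) (r s : nat -> G) : Prop :=
  exists m n, forall k, r (m + k)%N = s (n + k)%N.

(* In a tree two rays are equivalent iff they have a common tail; an end is an
   equivalence class of rays. *)
Definition is_end (G : sgraph) (xi : set (nat -> G)) : Prop :=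
  exists2 r, is_ray r & xi = [set s | is_ray s /\ tail_equiv r s].

(* The ray from v representing xi, unique when G is a tree and xi is an end. *)
Definition eta (G : sgraph) (xi : set (nat -> G)) (v : G) : nat -> G :=
  xget (fun=> v) [set r | xi r /\ r 0%N = v].

Definition meet (G : sgraph) (xi : set (nat -> G)) (x y : G) : G :=
  eta xi x (least [set n | range (eta xi y) (eta xi x n)]).

Definition busemann (G : sgraph) (o : G) (xi : set (nat -> G)) (x : G) : int :=
  (gdist o (meet xi x o))%:Z - (gdist x (meet xi x o))%:Z.

Section DiestelLeader.
Variables (T1 T2 : sgraph) (o1 : T1) (o2 : T2).
Variables (w1 : set (nat -> T1)) (w2 : set (nat -> T2)).

Definition DL_vertex : choiceType :=
  {x : T1 * T2 | busemann o1 w1 x.1 + busemann o2 w2 x.2 == 0}.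

Definition DL_adj : rel DL_vertex := fun x y =>
  adj (val x).1 (val y).1 && adj (val x).2 (val y).2.

Lemma DL_adj_sym : symmetric DL_adj.
Proof. by move=> x y; rewrite /DL_adj adj_sym [X in _ && X]adj_sym. Qed.

Lemma DL_adj_irr : irreflexive DL_adj.
Proof. by move=> x; rewrite /DL_adj adj_irr. Qed.

Definition DL : sgraph := SGraph DL_adj_sym DL_adj_irr.

End DiestelLeader.

(* Multigraphs with vertices in W and edges labelled by E; [mends e x y] means
   that e joins x and y. *)
Record mgraph (W E : Type) := MGraph {
  mverts : set W;
  medges : set E;
  mends : E -> W -> W -> Prop }.

(* A walk from x is the list of its (edge, next vertex) pairs. *)
Fixpoint mwalk (W E : Type) (M : mgraph W E) (T : set E)
    (x : W) (p : seq (E * W)) : Prop :=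
  if p is (e, y) :: p' then [/\ T e, mends M e x y & mwalk M T y p'] else True.

Definition mconnected (W E : Type) (M : mgraph W E) (T : set E) : Prop :=
  forall x y, mverts M x -> mverts M y ->
    exists p, mwalk M T x p /\ last x (unzip2 p) = y.

(* Distinct edges: two parallel edges form a cycle, but traversing one edge back
   and forth does not. *)
Definition macyclic (W E : choiceType) (M : mgraph W E) (T : set E) : Prop :=
  forall x p, p <> [::] -> mwalk M T x p -> last x (unzip2 p) = x ->
    ~ (uniq (unzip1 p) && uniq (unzip2 p)).

Definition spanning_tree (W E : choiceType) (M : mgraph W E) (T : set E) : Prop :=
  [/\ T `<=` medges M, mconnected M T & macyclic M T].

Definition edge (G : sgraph) : choiceType :=
  {e : {fset G} | `[< exists x y, adj x y /\ e = [fset x; y]%fset >]}.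

Definition config (G : sgraph) : Type := {ptws edge G -> bool}.

HB.instance Definition _ (G : sgraph) := Pointed.on (config G).
HB.instance Definition _ (G : sgraph) := Nbhs.on (config G).
HB.instance Definition _ (G : sgraph) := Topological.on (config G).

Definition borel (T : ptopologicalType) := g_sigma_algebraType (@open T).

(* The uniform measure on a finite nonempty set S, as an average of Dirac masses. *)
Definition uniform_measure (T : ptopologicalType) (R : realType) (S : set T) :
    {measure set (borel T) -> \bar R} :=
  let s : {fset T} := fset_set S in
  mscale (#|` s|%:R^-1)%:nng
    (msum (fun k => \d_(nth point s k : borel T)) #|` s|).

Definition UST (R : realType) (G : sgraph) (W : choiceType)
    (M : mgraph W (edge G)) : {measure set (borel (config G)) -> \bar R} :=
  uniform_measure R [set w : config G | spanning_tree M [set e | w e]].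

Definition weak_cvg (T : ptopologicalType) (R : realType)
    (mu_ : nat -> {measure set (borel T) -> \bar R})
    (mu : {measure set (borel T) -> \bar R}) : Prop :=
  forall f : T -> R, continuous f -> [bounded f x | x in setT] ->
    (\int[mu_ n]_x (f x)%:E)%E @[n --> \oo] --> (\int[mu]_x (f x)%:E)%E.

Section Forests.
Variable G : sgraph.
Implicit Types K : {fset G}.

Definition induced_mgraph K : mgraph G (edge G) :=
  MGraph [set x | x \in K] [set e | (val e `<=` K)%fset]
    (fun e x y => val e = [fset x; y]%fset).

(* Some x for x in K; all vertices outside K are identified to None. *)
Definition wire K (x : G) : option G := if x \in K then Some x else None.

Definition wired_mgraph K : mgraph (option G) (edge G) :=
  let ends e a b :=
    exists x y, [/\ val e = [fset x; y]%fset, a = wire K x & b = wire K y] in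
  MGraph (range (wire K)) [set e | ~ exists a, ends e a a] ends.

Definition induced_connected K : Prop :=
  mconnected (induced_mgraph K) (medges (induced_mgraph K)).

Definition exhaustion (K_ : nat -> {fset G}) : Prop :=
  [/\ forall n, K_ n != fset0 /\ induced_connected (K_ n),
      forall n, (K_ n `<=` K_ n.+1)%fset &
      forall x, exists n, x \in K_ n].

Definition is_FUSF (R : realType) (mu : probability (borel (config G)) R) :=
  exists2 K_, exhaustion K_ &
    weak_cvg (fun n => UST R (induced_mgraph (K_ n))) mu.

Definition is_WUSF (R : realType) (mu : probability (borel (config G)) R) :=
  exists2 K_, exhaustion K_ &
    weak_cvg (fun n => UST R (wired_mgraph (K_ n))) mu.

End Forests.

(* Main.v *)
(* On a finite graph with reduced incidence matrix B, Cauchy-Binet and total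
   unimodularity of B give P(no edge of F in the uniform spanning tree) =
   det(1 - Y_F), where Y is the matrix of unit currents. So FUSF and WUSF agree as
   soon as every pointwise limit of the currents is the same along free and wired
   exhaustions. The difference of two such limits is the gradient of a harmonic
   function h of finite Dirichlet energy on DL(q,r), and such an h is constant: the
   averages of h over the n-th generation of descendants of x in one
   tree (moving n steps towards the end in the other) converge geometrically to a
   limit C(x); rerouting through a large tetrahedron costs little energy, so C does
   not depend on x nor on the tree in which one descends. Hence |h(x) - C|
   is bounded by the energy along either of the two descending trees at x. Only
   finitely many x have both of these trees meeting a given finite set of edges, so
   h - C tends to 0 at infinity and the maximum principle gives h = C. *)
Require Import Defs.
From HB Require Import structures.
From mathcomp Require Import all_boot all_order all_algebra fingroup perm finmap.
From mathcomp Require Import all_classical all_reals all_analysis.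
From mathcomp Require Import zify ring lra.
Set Implicit Arguments.
Unset Strict Implicit.
Unset Printing Implicit Defensive.
Import Order.TTheory GRing.Theory Num.Theory.
Import numFieldNormedType.Exports.
Local Open Scope classical_set_scope.
Local Open Scope ring_scope.

(** * Spanning trees and determinants *)

(** Rates: a level at depth [n] carries at least [2 ^ n] edges, so by Cauchy-Schwarz a mean of the
    gradient over it is at most [sqrt (E / 2 ^ n)], and [3 / 4] is a rational bound for
    [1 / sqrt 2]. Crossing a tetrahedron of height [n] takes [n] steps, each averaging over at least
    [2 ^ n] edges; the total cost [n * (3 / 4) ^ n] still tends to 0. This is where branching at
    least 2 in both trees enters. Limits: the currents are not shown to converge beforehand. A
    single ultrafilter finer than [\oo] makes the free and the wired currents of all pairs of edges
    converge at once, and weak convergence persists along it. Once the limits agree, so do the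
    probabilities of all events that a finite set of edges is avoided; these events are closed under
    intersection and generate the Borel sets. Both kinds of finite graph are treated as multigraphs
    with a map from the vertices of [G] to theirs, so the determinant formula and the passage to the
    limit are proved once. *)

Lemma det_mul_expand (R : comNzRingType) m N (A : 'M[R]_(m, N)) (C : 'M[R]_(N, m)) :
  \det (A *m C) = \sum_(g : {ffun 'I_m -> 'I_N})
    (\prod_i C (g i) i) * \det (\matrix_(k, i) A k (g i)).
Proof.
rewrite -det_tr /determinant.
under eq_bigr => s _ do under eq_bigr => i _ do rewrite !mxE.
under eq_bigr => s _ do
  rewrite (bigA_distr_bigA (fun i j => A (s i) j * C j i)) mulr_sumr.
rewrite exchange_big /=; apply: eq_bigr => g _.
rewrite -/(determinant _) -det_tr /determinant mulr_sumr; apply: eq_bigr => s _.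
rewrite big_split /= mulrA mulrC; congr (_ * (_ * _)).
by apply: eq_bigr => i _; rewrite !mxE.
Qed.

(* Cauchy-Binet over ordered choices [g] of [m] columns, each set of columns being
   counted [m!] times. *)
Lemma det_weighted_gram (R : comNzRingType) m N (B : 'M[R]_(m, N)) (D : 'I_N -> R) :
  (m`!)%:R * \det (B *m \matrix_(j, i) (D j * B i j)) =
  \sum_(g : {ffun 'I_m -> 'I_N})
    (\prod_i D (g i)) * \det (\matrix_(k, i) B k (g i)) ^+ 2.
Proof.
have det_expand : \det (B *m \matrix_(j, i) (D j * B i j)) =
    \sum_(g : {ffun 'I_m -> 'I_N}) (\prod_i D (g i)) *
      ((\prod_i B i (g i)) * \det (\matrix_(k, i) B k (g i))).
  rewrite det_mul_expand; apply: eq_bigr => g _; rewrite mulrA -big_split /=.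
  by congr (_ * _); apply: eq_bigr => i _; rewrite mxE.
rewrite det_expand mulr_natl -card_Sn -sumr_const.
(* Precomposing [g] with [s] keeps the weight and multiplies the minor by the sign of [s]. Summing
   over [s] then turns the diagonal product into a second copy of the minor. *)
have shift (s : 'S_m) : \sum_(g : {ffun 'I_m -> 'I_N}) (\prod_i D (g i)) *
      ((\prod_i B i (g i)) * \det (\matrix_(k, i) B k (g i))) =
   \sum_(g : {ffun 'I_m -> 'I_N}) (\prod_i D (g i)) *
     (((-1) ^+ s * \prod_i B i (g (s i))) * \det (\matrix_(k, i) B k (g i))).
  have bij : bijective (fun g : {ffun 'I_m -> 'I_N} => [ffun i => g (s i)]).
    by exists (fun g : {ffun 'I_m -> 'I_N} => [ffun i => g ((s^-1)%g i)]) => g;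
      apply/ffunP => i; rewrite !ffunE ?permK ?permKV.
  rewrite (reindex _ (onW_bij _ bij)) /=; apply: eq_bigr => g _; congr (_ * _).
    by under eq_bigr => i _ do rewrite ffunE; rewrite [RHS](reindex_inj (@perm_inj _ s)).
  under eq_bigr => i _ do rewrite ffunE.
  rewrite -mulrA mulrCA; congr (_ * _).
  rewrite (_ : \det _ = \det (col_perm s (\matrix_(k, i) B k (g i)))).
    by rewrite col_permE det_mulmx det_perm odd_permV mulrC.
  by congr (\det _); apply/matrixP => k i; rewrite !mxE ffunE.
under eq_bigr => s _ do rewrite (shift s).
rewrite exchange_big /=; apply: eq_bigr => g _.
rewrite -mulr_sumr -mulr_suml expr2; congr (_ * (_ * _)).
rewrite /determinant; apply: eq_big => [s|s _]; first by rewrite inE.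
by congr (_ * _); apply: eq_bigr => i _; rewrite mxE.
Qed.

(** Two triangular factorizations of one block matrix. It trades a determinant indexed by vertices
    for one indexed by the avoided edges, whose size stays fixed along an exhaustion. *)
Lemma det_1subC (R : comNzRingType) m n (U : 'M[R]_(m, n)) (V : 'M[R]_(n, m)) :
  \det (1%:M - U *m V) = \det (1%:M - V *m U).
Proof.
have E1 : block_mx 1%:M U V 1%:M =
    block_mx 1%:M 0 V 1%:M *m block_mx 1%:M U 0 (1%:M - V *m U).
  by rewrite mulmx_block !(mul1mx, mulmx1, mul0mx, mulmx0, addr0, add0r) addrC subrK.
have E2 : block_mx 1%:M U V 1%:M =
    block_mx (1%:M - U *m V) U 0 1%:M *m block_mx 1%:M 0 V 1%:M.
  by rewrite mulmx_block !(mul1mx, mulmx1, mul0mx, mulmx0, addr0, add0r) subrK.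
have := congr1 (@determinant _ _) E1.
by rewrite E2 !det_mulmx !det_lblock !det_ublock !det1 !(mul1r, mulr1).
Qed.

(** * The matrix-tree theorem for finite multigraphs *)

Section FiniteMultigraph.
Variables (W E : choiceType) (M : mgraph W E) (m N : nat).
Variables (rt : W) (v : 'I_m -> W) (ed : 'I_N -> E) (s t : E -> W).
Hypothesis rt_v : forall i, v i <> rt.
Hypothesis v_inj : injective v.
Hypothesis vertsE : forall x, mverts M x <-> x = rt \/ exists i, x = v i.
Hypothesis ed_inj : injective ed.
Hypothesis edgesE : forall e, medges M e <-> exists j, e = ed j.
Hypothesis endsE : forall e x y, medges M e ->
  (mends M e x y <-> (x = s e /\ y = t e) \/ (x = t e /\ y = s e)).
Hypothesis s_verts : forall e, medges M e -> mverts M (s e).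
Hypothesis t_verts : forall e, medges M e -> mverts M (t e).
Hypothesis st_neq : forall e, medges M e -> s e <> t e.

(** The row of [rt] is left out, which makes the Laplacian invertible as soon as a spanning tree
    exists. Integer entries let invertible minors be recognized by determinant 1 or -1. *)
Definition incidence : 'M[int]_(m, N) :=
  \matrix_(i, j) ((t (ed j) == v i)%:R - (s (ed j) == v i)%:R).
Local Notation B := incidence.

Lemma ed_medges j : medges M (ed j). Proof. by apply/edgesE; exists j. Qed.

Lemma mends_sym e x y : medges M e -> mends M e x y -> mends M e y x.
Proof. by move=> eM /endsE - /(_ eM) h; apply/endsE => //; tauto. Qed.

Lemma mwalk_cat (T : set E) x p q :
  mwalk M T x p -> mwalk M T (last x (unzip2 p)) q -> mwalk M T x (p ++ q).
Proof. by elim: p x => [|[e y] p IH] x //= [Te xy /IH{}IH] /IH. Qed.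

Lemma mwalk_rev (T : set E) x p : T `<=` medges M -> mwalk M T x p ->
  exists2 q, mwalk M T (last x (unzip2 p)) q & last (last x (unzip2 p)) (unzip2 q) = x.
Proof.
move=> TM; elim: p x => [|[e y] p IH] x /=; first by exists [::].
move=> [Te xy /IH[q wq lq]]; exists (q ++ [:: (e, x)]).
  by apply: mwalk_cat => //=; rewrite lq; split=> //; apply: mends_sym => //; exact: TM.
by rewrite /unzip2 map_cat last_cat.
Qed.

(** The walk as an integral 1-chain: a passage through an edge counts +1 when it leaves from [s e]
    and -1 otherwise, unambiguous because there are no loops. Multiplication by [incidence] is the
    boundary map. *)
Fixpoint chain (x : W) (p : seq (E * W)) (j : 'I_N) : int :=
  if p is (e, y) :: p' then
    (e == ed j)%:R * (if x == s e then 1 else -1) + chain y p' j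
  else 0.

Lemma chain_notin x p j : ed j \notin unzip1 p -> chain x p j = 0.
Proof.
elim: p x => [|[e y] p IH] x //=; rewrite inE negb_or => /andP[/negbTE ne /IH ->].
by rewrite eq_sym ne mul0r addr0.
Qed.

Lemma boundary_chain (T : set E) x p i : T `<=` medges M -> mwalk M T x p ->
  \sum_j B i j * chain x p j = (last x (unzip2 p) == v i)%:R - (x == v i)%:R.
Proof.
move=> TM; elim: p x => [|[e y] p IH] x /=.
  by rewrite subrr big1 // => j _; rewrite mulr0.
move=> [Te xy wp]; under eq_bigr => j _ do rewrite mulrDr.
rewrite big_split /= IH // addrC.
suff -> : \sum_j B i j * ((e == ed j)%:R * (if x == s e then 1 else -1)) =
  (y == v i)%:R - (x == v i)%:R by rewrite addrA subrK.
have eM := TM _ Te; have /edgesE[j0 ej0] := eM.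
rewrite (bigD1 j0) //= big1 ?addr0 => [|j jj0]; last first.
  by rewrite ej0 (inj_eq ed_inj) eq_sym (negbTE jj0) mul0r mulr0.
rewrite ej0 eqxx mul1r mxE -ej0.
have := xy; rewrite endsE // => -[[-> ->]|[-> ->]]; first by rewrite eqxx mulr1.
by rewrite [t e == s e]eq_sym (negbTE (introN eqP (st_neq eM))) mulrN1 opprB.
Qed.

Lemma mwalk_mem (T : set E) x p e : mwalk M T x p -> e \in unzip1 p -> T e.
Proof.
elim: p x => [|[e' y] p IH] x //= [Te' _ /IH{}IH]; rewrite inE => /orP[/eqP->//|]; exact: IH.
Qed.

(** The adjugate stands in for the inverse, since a nonzero integer determinant need not be a
    unit. *)
Lemma mul_det_eq0 n (A : 'M[int]_n) (u : 'rV[int]_n) : u *m A = 0 -> \det A != 0 -> u = 0.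
Proof.
move=> uA0 dA; have : u *m A *m \adj A = 0 by rewrite uA0 mul0mx.
rewrite -mulmxA mul_mx_adj mul_mx_scalar => /matrixP h; apply/rowP => i.
by have /eqP := h 0 i; rewrite !mxE mulf_eq0 (negbTE dA) /= => /eqP.
Qed.

Definition minor (g : {ffun 'I_m -> 'I_N}) : 'M[int]_m := \matrix_(k, i) B k (g i).
Definition medgeset (X : {set 'I_N}) : set E := [set e | exists2 j, j \in X & e = ed j].
Local Notation img g := [set g x | x in [set: 'I_m]]%SET.

Lemma medgeset_sub X : medgeset X `<=` medges M.
Proof. by move=> e [j _ ->]; exact: ed_medges. Qed.

Lemma minor_ker g (c : 'I_N -> int) : \det (minor g) != 0 ->
  (forall j, j \notin img g -> c j = 0) -> injective g ->
  (forall i, \sum_j B i j * c j = 0) -> forall j, c j = 0.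
Proof.
move=> dg csupp gi cB j.
have [/imsetP[i _ ->]|/csupp//] := boolP (j \in img g).
suff /rowP/(_ i) : \row_i c (g i) = 0 :> 'rV[int]_m by rewrite !mxE.
apply: (@mul_det_eq0 _ (minor g)^T); last by rewrite det_tr.
apply/rowP => k; rewrite !mxE -[RHS](cB k).
rewrite [RHS](bigID (mem (img g))) /= [X in _ + X]big1 ?addr0 => [|j' /csupp ->]; last by rewrite mulr0.
rewrite big_imset /=; last by move=> ? ? _ _; exact: gi.
by apply: eq_big => [i'|i' _]; rewrite ?inE // !mxE mulrC.
Qed.

Lemma minor_inj g : \det (minor g) != 0 -> injective g.
Proof.
move=> dg i j gij; apply/eqP/negPn/negP => ij.
move: dg; rewrite -det_tr (determinant_alternate ij) ?eqxx // => k.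
by rewrite !mxE gij.
Qed.

(** Both ways to fail produce a kernel vector: the indicator of the vertices not reached from [rt]
    is killed from the left, and the chain of a cycle is killed from the right. *)
Lemma minor_tree g : \det (minor g) != 0 -> spanning_tree M (medgeset (img g)).
Proof.
move=> dg; have gi := minor_inj dg; have TM := @medgeset_sub (img g).
set T := medgeset _; split=> //.
- pose reach x := `[< exists2 p, mwalk M T rt p & last rt (unzip2 p) = x >].
  have reach_step e x y : T e -> mends M e x y -> reach x -> reach y.
    move=> Te xy /asboolP[p wp lp]; apply/asboolP; exists (p ++ [:: (e, y)]).
      by apply: mwalk_cat => //=; rewrite lp.
    by rewrite /unzip2 map_cat last_cat.
  have reach_rt : reach rt by apply/asboolP; exists [::].
  have u0 : \row_i (~~ reach (v i))%:R = 0 :> 'rV[int]_m.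
    apply: (mul_det_eq0 _ dg); apply/rowP => i; rewrite !mxE.
    have Te : T (ed (g i)) by exists (g i) => //; apply: imset_f; rewrite inE.
    set e := ed (g i) in Te *; have eM := TM _ Te.
    have sumE x : mverts M x ->
        \sum_k (~~ reach (v k))%:R * (x == v k)%:R = (~~ reach x)%:R :> int.
      move=> /vertsE[->|[k0 ->]].
        by rewrite reach_rt big1 // => k _; rewrite (negbTE (introN eqP (nesym (@rt_v k)))) mulr0.
      rewrite (bigD1 k0) //= eqxx mulr1 big1 ?addr0 // => k kk0.
      by rewrite (inj_eq v_inj) eq_sym (negbTE kk0) mulr0.
    transitivity ((~~ reach (t e))%:R - (~~ reach (s e))%:R : int).
      rewrite -!sumE; [|exact: s_verts|exact: t_verts].
      by rewrite -sumrB; apply: eq_bigr => k _; rewrite !mxE mulrBr.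
    suff -> : reach (t e) = reach (s e) by rewrite subrr.
    by apply/idP/idP; apply: (reach_step e) => //; apply/endsE => //; tauto.
  have all_reach x : mverts M x -> reach x.
    move=> /vertsE[->//|[i ->]]; have /rowP/(_ i) := u0; rewrite !mxE.
    by case: (reach (v i)).
  move=> x y /all_reach/asboolP[p wp lp] /all_reach/asboolP[q wq lq].
  have [p' wp' lp'] := mwalk_rev TM wp; rewrite lp in wp' lp'.
  exists (p' ++ q); split; first by apply: mwalk_cat => //; rewrite lp'.
  by rewrite /unzip2 map_cat last_cat -/(unzip2 _) lp' lq.
- move=> x p pn wp lp /andP[up _].
  have c0 := @minor_ker g (chain x p) dg.
  case: p pn wp lp up c0 => [//|[e y] p] _ wp lp /= /andP[ep up] c0.
  have [Te _ _] := wp; have [j _ ej] := Te.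
  have /(_ j) : forall j, chain x ((e, y) :: p) j = 0.
    apply: c0 => // [j' j'n|i].
      apply: (@chain_notin x ((e, y) :: p)); apply/negP => /(mwalk_mem wp)[j2 j2i /ed_inj j2E].
      by rewrite j2E j2i in j'n.
    by rewrite (boundary_chain i TM wp) lp subrr.
  (* The first edge of the cycle does not recur, so its coefficient is 1 or -1 and the chain is not
     0. *)
  rewrite /= chain_notin -?ej // addr0 eqxx mul1r.
  by case: ifP.
Qed.

(** Column [i] is the chain of a walk in [T] from [rt] to [v i]. Its boundary is the [i]-th unit
    vector because the root has no row. *)
Lemma connected_right_inverse (T : set E) : T `<=` medges M -> mconnected M T ->
  exists2 C : 'M[int]_(N, m), B *m C = 1%:M & forall j i, ~ T (ed j) -> C j i = 0.
Proof.
move=> TM conn.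
have /choice[p pP] : forall i, exists p, mwalk M T rt p /\ last rt (unzip2 p) = v i.
  by move=> i; apply: conn; apply/vertsE; [left|right; exists i].
exists (\matrix_(j, i) chain rt (p i) j); last first.
  move=> j i nT; rewrite mxE; apply: chain_notin; apply/negP.
  by move=> /(mwalk_mem (pP i).1).
apply/matrixP => k i; rewrite !mxE.
under eq_bigr => j _ do rewrite [X in _ * X]mxE.
rewrite (boundary_chain k TM (pP i).1) (pP i).2 (inj_eq v_inj).
by rewrite (negbTE (introN eqP (nesym (@rt_v k)))) subr0 eq_sym.
Qed.

(* The tree paths from the root form an integral inverse of the minor. *)
Lemma minor_sqr (g : {ffun 'I_m -> 'I_N}) : injective g -> mconnected M (medgeset (img g)) ->
  \det (minor g) ^+ 2 = 1.
Proof.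
move=> gi conn; have [C BC Csupp] := connected_right_inverse (@medgeset_sub _) conn.
have : minor g *m \matrix_(i, l) C (g i) l = 1%:M.
  rewrite -BC; apply/matrixP => k l; rewrite !mxE.
  rewrite [RHS](bigID (mem (img g))) /= [X in _ + X]big1 ?addr0 => [|j /negP jn]; last first.
    by rewrite Csupp ?mulr0 // => -[j' j'i /ed_inj jj']; apply: jn; rewrite jj'.
  rewrite big_imset /=; last by move=> ? ? _ _; exact: gi.
  by apply: eq_big => [i'|i' _]; rewrite ?inE // !mxE.
move/(congr1 (@determinant _ _)); rewrite det_mulmx det1 mulrC => /intUnitRing.unitzPl.
by rewrite qualifE /= => /orP[] /eqP ->; rewrite ?sqrrN expr1n.
Qed.

(** A later passage through the first edge would visit its endpoint [x] again. Needed because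
    [macyclic] speaks only of closed walks without repeated edges. *)
Lemma mwalk_uniq_edges x p T : T `<=` medges M -> mwalk M T x p -> uniq (x :: unzip2 p) ->
  uniq (unzip1 p).
Proof.
move=> TM; elim: p x => [|[e y] p IH] x //= [Te xy wp].
rewrite inE negb_or => /andP[/andP[xy_n xp] uyp].
rewrite (IH y) // andbT; apply/negP => ep.
have eM := TM _ Te.
have incident z q : mwalk M T z q -> e \in unzip1 q ->
    forall a b, mends M e a b -> a \in z :: unzip2 q.
  elim: q z => [|[e' z'] q IHq] z //= [Te' zz' wq].
  rewrite inE => /orP[/eqP ee'|/(IHq _ wq){}IHq] a b; last first.
    by move=> /IHq h; rewrite in_cons h orbT.
  move: zz'; rewrite -ee' => /endsE -/(_ eM) zz' /endsE -/(_ eM) ab.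
  rewrite !inE; case: zz' ab => -[-> ->] [] [-> _]; by rewrite eqxx ?orbT.
have := incident y p wp ep x y xy.
by rewrite inE (negbTE xy_n) (negbTE xp).
Qed.

Lemma mwalk_simple (T : set E) x p : mwalk M T x p ->
  exists q, [/\ mwalk M T x q, last x (unzip2 q) = last x (unzip2 p) & uniq (x :: unzip2 q)].
Proof.
pose r a b := `[< exists2 e, T e & mends M e a b >].
have path_of z w : mwalk M T z w -> path r z (unzip2 w).
  elim: w z => [|[e y] w IH] z //= [Te zy /IH ->]; rewrite andbT.
  by apply/asboolP; exists e.
have of_path z w : path r z w -> exists2 q, mwalk M T z q & unzip2 q = w.
  elim: w z => [|y w IH] z /=; first by exists [::].
  move=> /andP[/asboolP[e Te zy] /IH[q wq qw]]; exists ((e, y) :: q) => //=.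
  by rewrite qw.
move=> /path_of/shortenP[p' /of_path[q wq <-] uq _].
by exists q.
Qed.

(** Expanding [det (B C) = 1] for the right inverse [C] supported on [T] leaves a nonzero term,
    hence a nonzero minor with columns in [T]. Its edges form a spanning tree inside [T], and any
    further edge of [T] would close a cycle with it. *)
Lemma tree_minor (T : set E) : spanning_tree M T ->
  exists2 g, \det (minor g) != 0 & medgeset (img g) = T.
Proof.
move=> [TM conn acyc]; have [C BC Csupp] := connected_right_inverse TM conn.
have := det_mul_expand B C; rewrite BC det1 => sum1.
have [g gP] : exists g : {ffun 'I_m -> 'I_N},
    (\prod_i C (g i) i) * \det (minor g) != 0.
  apply: contrapT => /forallNP no; have := oner_neq0 int.
  rewrite sum1 big1 ?eqxx // => g _; apply/eqP; have := no g.
  by move=> /negP; rewrite negbK.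
move: gP; rewrite mulf_eq0 negb_or => /andP[/prodf_neq0 Cg dg].
exists g => //; have [TgM connT _] := minor_tree dg.
have TgT : medgeset (img g) `<=` T.
  move=> _ [_ /imsetP[i _ ->] ->]; apply: contrapT => nT.
  by have := Cg i isT; rewrite Csupp // eqxx.
apply/seteqP; split=> // e Te; apply: contrapT => nTg.
have eM := TM _ Te.
have [p [wp lp]] := connT _ _ (t_verts eM) (s_verts eM).
have [q [wq lq uq]] := mwalk_simple wp.
have wqT : mwalk M T (t e) q.
  by elim: q (t e) wq {lq uq} => [|[e' y] q IH] z //= [/TgT ? ? /IH].
apply: (acyc (s e) ((e, t e) :: q)) => //=.
- by split=> //; apply/endsE => //; left.
- by rewrite lq.
- have -> : uniq (unzip1 q) by apply: mwalk_uniq_edges wq uq.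
  move: uq => /= ->; rewrite !andbT; apply/negP => /(mwalk_mem wq); exact: nTg.
Qed.

Definition trees (D : {set 'I_N}) : {set {set 'I_N}} :=
  [set X | `[< spanning_tree M (medgeset X) >] && (X \subset D)]%SET.

Lemma medgeset_inj : injective medgeset.
Proof.
move=> X Y /seteqP[XY YX]; apply/setP => j; apply/idP/idP => jX.
  by have [|k kY /ed_inj ->] := XY (ed j); first by exists j.
by have [|k kY /ed_inj ->] := YX (ed j); first by exists j.
Qed.

(** Matrix-tree theorem with weight 1 on [D] and 0 elsewhere: in the Gram expansion the nonzero
    terms equal 1, and each tree inside [D] arises from [m!] orderings of its [m] edges. *)
Lemma card_trees (D : {set 'I_N}) :
  (#|trees D|)%:R = \det (B *m \matrix_(j, i) ((j \in D)%:R * B i j)) :> int.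
Proof.
have m0 : (m`!)%:R != 0 :> int by rewrite pnatr_eq0 -lt0n fact_gt0.
apply: (mulfI m0); rewrite (det_weighted_gram B (fun j => (j \in D)%:R)).
pose G (g : {ffun 'I_m -> 'I_N}) := (\det (minor g) != 0) && (img g \subset D).
transitivity ((\sum_g G g)%N%:R : int); last first.
  rewrite natr_sum; apply: eq_bigr => g _; rewrite -/(minor g) /G.
  have [d0|d0] /= := eqVneq (\det (minor g)) 0; first by rewrite d0 expr0n mulr0.
  have [_ conn _] := minor_tree d0; rewrite (minor_sqr (minor_inj d0) conn) mulr1.
  have [/fintype.subsetP gD|/fintype.subsetPn[j /imsetP[i _ ->] gi]] := boolP (img g \subset D).
    by rewrite big1 // => i _; rewrite gD ?imset_f ?inE.
  by rewrite (bigD1 i) //= (negbTE gi) mul0r.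
rewrite -natrM; congr (_%:R).
have -> : (\sum_g G g = \sum_(g | G g) 1)%N.
  by rewrite [RHS]big_mkcond; apply: eq_bigr => g _; case: (G g).
rewrite (partition_big (fun g : {ffun 'I_m -> 'I_N} => img g) (mem (trees D))) /=; last first.
  by move=> g /andP[d0 gD]; rewrite inE gD andbT; apply/asboolP/minor_tree.
rewrite -sum1_card big_distrr /=; apply: eq_bigr => X; rewrite inE muln1.
move=> /andP[/asboolP XT XD]; have [g0 d0 /medgeset_inj g0X] := tree_minor XT.
have cX : #|X| = m.
  by rewrite -g0X card_imset ?cardsT ?card_ord //; exact: minor_inj.
rewrite sum1dep_card.
transitivity #|[set f in ffun_on (mem X) | injectiveb (f : {ffun 'I_m -> 'I_N})]|.
  by rewrite card_inj_ffuns_on cX card_ord ffactnn.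
apply: eq_card => g; rewrite !inE /G.
apply/andP/andP => [[/ffun_onP gX /injectiveP gi]|[/andP[d1 _] /eqP gX]]; last first.
  split; last by apply/injectiveP/minor_inj.
  by apply/ffun_onP => i; rewrite -gX imset_f // inE.
have gXE : img g = X.
  apply/eqP; rewrite eqEcard cX card_imset // cardsT card_ord leqnn andbT.
  by apply/fintype.subsetP => _ /imsetP[i _ ->]; exact: gX.
rewrite gXE XD; split=> //; apply/andP; split=> //; apply/eqP => dg0.
have [_ conn _] := XT; rewrite -gXE in conn.
by have := minor_sqr gi conn; rewrite dg0 expr0n => /eqP.
Qed.

(** * Unit currents and the transfer current theorem *)

Section TransferCurrent.
Variable R : realFieldType.
Local Notation BR := (map_mx (intr : int -> R) B).
Local Notation L := (BR *m BR^T).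

(** The voltage, grounded at [rt], of the unit current between the ends of edge [j]: it solves the
    reduced Laplace equation and is extended by 0. *)
Definition potential (j : 'I_N) (x : W) : R :=
  \sum_i (x == v i)%:R * (invmx L *m col j BR) i 0.

Local Notation d j k := (potential j (t (ed k)) - potential j (s (ed k))).

Lemma potential_diff j k : d j k = (BR^T *m (invmx L *m col j BR)) k 0.
Proof.
rewrite mxE -sumrB; apply: eq_bigr => i _; rewrite -mulrBl; congr (_ * _).
by rewrite !mxE rmorphB /= !rmorph_nat.
Qed.

(** The rows of the full incidence matrix sum to 0, so the node law at all other vertices implies it
    at [rt]. *)
Lemma incidence_node (x : W) (a : 'I_N -> R) : mverts M x ->
  (forall i, \sum_k BR i k * a k = 0) ->
  \sum_k ((t (ed k) == x)%:R - (s (ed k) == x)%:R) * a k = 0.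
Proof.
move=> /vertsE[->|[i ->]] aB; last first.
  by rewrite -[RHS](aB i); apply: eq_bigr => k _; rewrite !mxE rmorphB /= !rmorph_nat.
have sum1 y : mverts M y -> (y == rt)%:R = 1 - \sum_i (y == v i)%:R :> R.
  move=> /vertsE[->|[i0 ->]].
    by rewrite eqxx big1 ?subr0 // => k _; rewrite (negbTE (introN eqP (nesym (@rt_v k)))).
  rewrite (bigD1 i0) //= eqxx big1 ?addr0 ?subrr ?(negbTE (introN eqP (@rt_v i0))) // => k kk0.
  by rewrite (inj_eq v_inj) eq_sym (negbTE kk0).
transitivity (- \sum_i \sum_k BR i k * a k); last by rewrite big1 ?oppr0.
rewrite exchange_big /= -sumrN; apply: eq_bigr => k _.
rewrite !sum1; [|exact/s_verts/ed_medges|exact/t_verts/ed_medges].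
rewrite -mulr_suml -mulNr; congr (_ * _).
have -> : \sum_i BR i k = \sum_i (t (ed k) == v i)%:R - \sum_i (s (ed k) == v i)%:R.
  by rewrite -sumrB; apply: eq_bigr => i _; rewrite !mxE rmorphB /= !rmorph_nat.
move: (\sum_i _) (\sum_i _) => a1 a2; ring.
Qed.

Lemma det_trees (D : {set 'I_N}) :
  \det (BR *m \matrix_(j, i) ((j \in D)%:R * BR i j)) = (#|trees D|)%:R.
Proof.
rewrite -(rmorph_nat (intr : int -> R)) card_trees -det_map_mx map_mxM /=.
congr (\det (_ *m _)); apply/matrixP => j i.
by rewrite !mxE !rmorphM !rmorphB /= !rmorph_nat.
Qed.

Lemma det_laplacian : \det L = (#|trees [set: 'I_N]|)%:R.
Proof.
rewrite -det_trees; congr (\det (_ *m _)); apply/matrixP => j i.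
by rewrite !mxE inE mul1r.
Qed.

Hypothesis trees_neq0 : #|trees [set: 'I_N]| != 0%N.

Lemma laplacian_unit : L \in unitmx.
Proof. by rewrite unitmxE det_laplacian unitfE pnatr_eq0. Qed.

Lemma potential_node j x : mverts M x ->
  \sum_k ((t (ed k) == x)%:R - (s (ed k) == x)%:R) * d j k =
  (t (ed j) == x)%:R - (s (ed j) == x)%:R.
Proof.
move=> xM; apply/eqP; rewrite -subr_eq0; apply/eqP.
rewrite -[RHS](@incidence_node x (fun k => d j k - (k == j)%:R) xM).
  rewrite -[X in _ - X](_ : \sum_k ((t (ed k) == x)%:R - (s (ed k) == x)%:R) * (k == j)%:R = _).
    by rewrite -sumrB; apply: eq_bigr => k _; rewrite [RHS]mulrBr.
  rewrite (bigD1 j) //= eqxx mulr1 big1 ?addr0 // => k /negbTE ->.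
  by rewrite mulr0.
move=> i; under eq_bigr => k _ do rewrite mulrBr.
rewrite sumrB [X in _ - X](_ : _ = BR i j); last first.
  rewrite (bigD1 j) //= eqxx mulr1 big1 ?addr0 // => k /negbTE ->.
  by rewrite mulr0.
under eq_bigr => k _ do rewrite potential_diff.
have := congr1 (fun A : 'cV_m => A i 0)
  (mulKVmx laplacian_unit (col j BR) : L *m (invmx L *m col j BR) = _).
by rewrite -mulmxA [in X in X -> _]mxE [in X in _ = X -> _]mxE => ->; rewrite subrr.
Qed.

(** The energy of the unit current equals its voltage drop [d j j] across edge [j]. As
    [(d j j) ^+ 2] is one of the summands, the energy dominates its own square. *)
Lemma potential_energy j : \sum_k d j k ^+ 2 <= 1.
Proof.
set e := (X in X <= _).
have eE : e = d j j.
  rewrite potential_diff; set w := invmx L *m col j BR.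
  have -> : (BR^T *m w) j 0 = (w^T *m col j BR) 0 0.
    by rewrite !mxE; apply: eq_bigr => i _; rewrite !mxE mulrC.
  have -> : col j BR = L *m w by rewrite mulKVmx // laplacian_unit.
  have -> : w^T *m (L *m w) = (BR^T *m w)^T *m (BR^T *m w).
    by rewrite [in RHS]trmx_mul trmxK !mulmxA.
  rewrite [RHS]mxE.
  by rewrite /e; apply: eq_bigr => k _; rewrite potential_diff expr2 [X in _ = X * _]mxE.
have : (d j j) ^+ 2 <= e.
  rewrite /e (bigD1 j) //= lerDl; apply: sumr_ge0 => k _; exact: sqr_ge0.
rewrite -eE expr2 -subr_le0 -[X in _ - X]mulr1 -mulrBr.
have e0 : 0 <= e by apply: sumr_ge0 => k _; exact: sqr_ge0.
have [/eqP -> _|/negbTE en0] := boolP (e == 0); first exact: ler01.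
by rewrite pmulr_rle0 ?subr_le0 // lt_neqAle eq_sym en0.
Qed.

(** Deleting the edges of [F] changes the Laplacian into [L (1 - L^-1 BF BF^T)]. [det_1subC] moves
    the second factor to a matrix indexed by [F], whose entries are voltage drops. *)
Lemma det_transfer n (f : 'I_n -> 'I_N) : injective f ->
  (#|trees (~: [set f a | a in [set: 'I_n]])%SET|)%:R =
  (#|trees [set: 'I_N]|)%:R * \det (1%:M - \matrix_(a, b) d (f b) (f a)) :> R.
Proof.
move=> fi; rewrite -det_laplacian -det_trees.
set F := [set f a | a in [set: 'I_n]]%SET.
pose BF : 'M[R]_(m, n) := \matrix_(i, b) BR i (f b).
have -> : BR *m \matrix_(j, i) ((j \in ~: F)%:R * BR i j) =
    L *m (1%:M - (invmx L *m BF) *m BF^T).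
  rewrite mulmxBr mulmx1 mulmxA mulKVmx ?laplacian_unit //.
  apply/matrixP => i k; rewrite [RHS]mxE [X in _ = _ + X]mxE ![X in X = _]mxE ![X in _ = X - _]mxE ![X in _ = _ - X]mxE.
  have -> : \sum_a BF i a * BF^T a k = \sum_(j in F) BR i j * BR k j.
    rewrite big_imset /=; last by move=> ? ? _ _; exact: fi.
    by apply: eq_big => [a|a _]; rewrite ?inE // !mxE.
  rewrite [X in _ = _ - X]big_mkcond -sumrB; apply: eq_bigr => j _.
  by rewrite mxE inE [BR^T _ _]mxE; case: (j \in F); rewrite ?mul0r ?mulr0 ?subrr ?mul1r ?subr0.
rewrite det_mulmx det_1subC; congr (_ * \det (_ - _)).
apply/matrixP => a b; rewrite [RHS]mxE potential_diff !mxE; apply: eq_bigr => i _.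
rewrite !mxE; congr (_ * _); apply: eq_bigr => k _; by rewrite !mxE.
Qed.

End TransferCurrent.
End FiniteMultigraph.

Lemma card_eq_finset (T : finType) (A : {set T}) :
  ([set x | x \in A] #= `I_#|A|)%card.
Proof.
have -> : [set x | x \in A] = [set enum_val i | i in [set: 'I_#|A|]].
  apply/seteqP; split=> [x /= xA|_ [i _ <-]]; last exact: enum_valP.
  by exists (enum_rank_in xA x) => //; rewrite enum_rankK_in.
apply: card_eq_trans (inj_card_eq _) _; first by move=> i j _ _ /enum_val_inj.
by rewrite card_eq_sym card_II.
Qed.

Lemma finite_set_enum (T : choiceType) (A : set T) : finite_set A ->
  exists (n : nat) (f : 'I_n -> T), [/\ injective f,
    forall x, A x <-> exists i, x = f i &
    forall (R : nmodType) (F : T -> R), \sum_(x <- fset_set A) F x = \sum_i F (f i)].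
Proof.
move=> Afin; pose K := fset_set A.
exists #|{: K}|, (fun i => val (enum_val i : K)); split.
- by move=> i j /val_inj/enum_val_inj.
- move=> x; split=> [Ax|[i ->]]; last first.
    have := valP (enum_val i : K); by rewrite in_fset_set // inE.
  have xK : x \in K by rewrite in_fset_set // inE.
  by exists (enum_rank [` xK]%fset); rewrite enum_rankK.
- move=> R F; rewrite big_seq_fsetE /=.
  by rewrite (reindex _ (onW_bij _ (enum_val_bij K))).
Qed.

Lemma card_trees_avoiding (W E : choiceType) (M : mgraph W E) N (ed : 'I_N -> E)
    (D : {set 'I_N}) : injective ed -> (forall e, medges M e <-> exists j, e = ed j) ->
  ([set w : E -> bool | spanning_tree M [set e | w e] /\
     forall j, j \notin D -> w (ed j) = false] #= `I_#|trees M ed D|)%card.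
Proof.
move=> ed_inj edgesE; apply: card_eq_trans (card_eq_finset _).
pose F (X : {set 'I_N}) : E -> bool := fun e => `[< medgeset ed X e >].
have FE X : [set e | F X e] = medgeset ed X.
  by apply/seteqP; split=> e /=; [move=> /asboolP|move=> ?; apply/asboolP].
have Fin X j : F X (ed j) = (j \in X).
  by apply/asboolP/idP => [[k kX /ed_inj ->]//|jX]; exists j.
suff -> : [set w : E -> bool | spanning_tree M [set e | w e] /\
     forall j, j \notin D -> w (ed j) = false] = F @` [set X | X \in trees M ed D].
  by apply: inj_card_eq => X Y _ _ XY; apply/setP => j; rewrite -!Fin XY.
apply/seteqP; split=> [w [wT wD]|_ [X XT <-]] /=; last first.
  move: XT; rewrite /= inE => /andP[/asboolP XT /fintype.subsetP XD].
  rewrite FE; split=> // j jD; rewrite Fin; apply: contraNF jD; exact: XD.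
pose X := [set j | w (ed j)]%SET.
have XE : F X = w.
  apply/funext => e; rewrite /F; apply/asboolP/idP => [[j]|we].
    by rewrite inE => ? ->.
  have [TM _ _] := wT; have /edgesE[j ej] := TM _ we.
  by exists j => //; rewrite inE -ej.
exists X => //; rewrite inE; apply/andP; split.
  by apply/asboolP; rewrite -FE XE.
apply/fintype.subsetP => j; rewrite inE; apply: contraTT => /wD ->.
by [].
Qed.

(* [phi e] is the potential of the unit current flow from one end of [e] to the
   other; the last clause is the transfer current theorem for the event that a
   uniform spanning tree avoids given edges. *)
Definition transfer_potential (R : realFieldType) (W E : choiceType) (M : mgraph W E)
    (s t : E -> W) (n0 : nat) (phi : E -> W -> R) : Prop :=
  [/\ forall e x, medges M e -> mverts M x ->
        \sum_(g <- fset_set (medges M)) ((t g == x)%:R - (s g == x)%:R) *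
          (phi e (t g) - phi e (s g)) = (t e == x)%:R - (s e == x)%:R,
      forall e, medges M e ->
        \sum_(g <- fset_set (medges M)) (phi e (t g) - phi e (s g)) ^+ 2 <= 1 &
      forall n (f : 'I_n -> E), injective f -> (forall a, medges M (f a)) ->
        exists2 n1 : nat,
          ([set w : E -> bool | spanning_tree M [set e | w e] /\
            forall a, w (f a) = false] #= `I_n1)%card &
        n1%:R = n0%:R * \det (1%:M -
          \matrix_(a, b) (phi (f b) (t (f a)) - phi (f b) (s (f a)))) :> R].

(** No connectedness is assumed, so there may be no spanning tree; the Laplacian is invertible
    exactly when [n0] is nonzero, whence the conditional form. *)
Lemma finite_transfer_current (R : realFieldType) (W E : choiceType)
    (M : mgraph W E) (s t : E -> W) :
  finite_set (mverts M) -> mverts M !=set0 -> finite_set (medges M) ->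
  (forall e x y, medges M e ->
    (mends M e x y <-> (x = s e /\ y = t e) \/ (x = t e /\ y = s e))) ->
  (forall e, medges M e -> [/\ mverts M (s e), mverts M (t e) & s e <> t e]) ->
  exists2 n0 : nat,
    ([set w : E -> bool | spanning_tree M [set e | w e]] #= `I_n0)%card &
  (n0 != 0)%N -> exists phi : E -> W -> R, transfer_potential M s t n0 phi.
Proof.
move=> Vfin [rt rtM] Efin endsE stM.
have [m [v [v_inj vE _]]] := finite_set_enum (finite_setD [set rt] Vfin).
have [N [ed [ed_inj edgesE sumE]]] := finite_set_enum Efin.
have rt_v i : v i <> rt by have [_] : (mverts M `\ rt) (v i) by apply/vE; exists i.
have vertsE x : mverts M x <-> x = rt \/ exists i, x = v i.
  rewrite -vE; split=> [xM|[->//|[]//]].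
  by have [->|/eqP xr] := eqVneq x rt; [left|right].
have sM e : medges M e -> mverts M (s e) by case/stM.
have tM e : medges M e -> mverts M (t e) by case/stM.
have st e : medges M e -> s e <> t e by case/stM.
exists #|trees M ed [set: 'I_N]|.
  have := card_trees_avoiding [set: 'I_N] ed_inj edgesE.
  congr (_ #= _)%card; apply/seteqP; split=> [w []//|w wT]; split=> // j.
  by rewrite inE.
move=> n0.
(* The sum selects the index of [e] without inverting [ed], and gives 0 off the edge set. *)
pose phi e x := \sum_j (ed j == e)%:R * potential v ed s t R j x.
have phiE j : phi (ed j) = potential v ed s t R j.
  apply/funext => x; rewrite /phi (bigD1 j) //= eqxx mul1r big1 ?addr0 // => k kj.
  by rewrite (inj_eq ed_inj) (negbTE kj) mul0r.
exists phi; split.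
- move=> e x /edgesE[j ->] xM; rewrite sumE phiE.
  exact: potential_node.
- by move=> e /edgesE[j ->]; rewrite sumE phiE; exact: potential_energy.
- move=> n f f_inj fM.
  have /choice[g gE] : forall a, exists j, f a = ed j by move=> a; apply/edgesE.
  have g_inj : injective g by move=> a b gab; apply: f_inj; rewrite !gE gab.
  pose F := [set g a | a in [set: 'I_n]%SET]%SET.
  exists #|trees M ed (~: F)%SET|.
    have := card_trees_avoiding (~: F)%SET ed_inj edgesE.
    congr (_ #= _)%card; apply/seteqP; split=> w [wT h]; split=> //.
      by move=> a; rewrite gE h // inE negbK imset_f ?inE.
    by move=> j; rewrite inE negbK => /imsetP[a _ ->]; rewrite -gE.
  rewrite (@det_transfer _ _ M m N rt v ed s t) //.
  congr (_ * \det (_ - _)); apply/matrixP => a b.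
  by rewrite !mxE !gE phiE.
Qed.

(** * Harmonic Dirichlet functions on horocyclic products *)

Section GeometricEstimates.
Variable R : realType.
Implicit Types (x c K : R) (u : nat -> R).

(** The base [6 / 5] is chosen so that [6 / 5 * (3 / 4) = 9 / 10] is below 1: a linear factor is
    absorbed into a slower geometric decay. *)
Lemma bernoulli_65 (n : nat) : n%:R <= 5 * (6 / 5) ^+ n :> R.
Proof.
suff : 1 + n%:R / 5 <= (6 / 5) ^+ n :> R by lra.
elim: n => [|n IH]; first by rewrite expr0; lra.
have n0 : 0 <= n%:R :> R by [].
by rewrite exprS -natr1; nra.
Qed.

Lemma geometric_vanish x K : (forall n : nat, `|x| <= K * (9 / 10) ^+ n) -> x = 0.
Proof.
move=> xK; apply/eqP; rewrite -normr_eq0 eq_le normr_ge0 andbT.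
have cv : (fun n : nat => K * (9 / 10) ^+ n) @ \oo --> (K * 0 : R).
  by apply: cvgMl_tmp; apply: cvg_expr; rewrite ger0_norm; lra.
rewrite mulr0 in cv.
rewrite -(cvg_lim _ cv) //; apply: limr_ge; [exact: cvgP cv|exact: nearW].
Qed.

(** The rate [3 / 4] works because its square [9 / 16] exceeds [1 / 2]. *)
Lemma normr_le_sqrt x c (n : nat) : 0 <= c -> x ^+ 2 <= c / 2 ^+ n ->
  `|x| <= Num.sqrt c * (3 / 4) ^+ n.
Proof.
move=> c0 xc; have r0 : 0 <= (3 / 4 : R) by lra.
rewrite -(@ler_pXn2r _ 2%N) ?nnegrE ?mulr_ge0 ?sqrtr_ge0 ?exprn_ge0 //.
rewrite real_normK ?num_real // exprMn sqr_sqrtr //; apply: le_trans xc _.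
apply: ler_wpM2l => //; rewrite -exprVn -exprM mulnC exprM.
by apply: lerXn2r; rewrite ?nnegrE; lra.
Qed.

(** The intervals of radius [g n = 4 K (3 / 4) ^ n] around [u n] are nested, since
    [g n - g n.+1 = K (3 / 4) ^ n]; the limit is the supremum of their left ends. *)
Lemma geometric_limit u K : (forall n, `|u n.+1 - u n| <= K * (3 / 4) ^+ n) ->
  exists C, forall n, `|u n - C| <= 4 * K * (3 / 4) ^+ n.
Proof.
move=> uK; pose g n : R := 4 * K * (3 / 4) ^+ n.
have step n : u n - g n <= u n.+1 - g n.+1 /\ u n.+1 + g n.+1 <= u n + g n.
  have := uK n; rewrite /g exprS ler_norml => /andP[]; lra.
have lo n m : u n - g n <= u (n + m)%N - g (n + m)%N.
  by elim: m => [|m IH]; rewrite ?addn0 // addnS (le_trans IH) // (step _).1.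
have hi n m : u (n + m)%N + g (n + m)%N <= u n + g n.
  by elim: m => [|m IH]; rewrite ?addn0 // addnS (le_trans _ IH) // (step _).2.
have g0 n : 0 <= g n.
  have : 0 <= K * (3 / 4) ^+ n := le_trans (normr_ge0 _) (uK n).
  by rewrite /g; lra.
pose S := range (fun n => u n - g n).
have ub m : ubound S (u m + g m).
  move=> _ [n _ <-]; have := lo n m; have := hi m n; rewrite addnC.
  by have := g0 (n + m)%N; lra.
exists (sup S) => n; rewrite -/(g n) ler_norml; apply/andP; split.
  have : sup S <= u n + g n by apply: ge_sup => //; exists (u 0%N - g 0%N), 0%N.
  lra.
have : u n - g n <= sup S by apply: ub_le_sup; [exists (u 0%N + g 0%N); exact: ub|exists n].
lra.
Qed.

Lemma sqr_sum_le (T : Type) (s : seq T) (f : T -> R) :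
  (\sum_(x <- s) f x) ^+ 2 <= (size s)%:R * \sum_(x <- s) f x ^+ 2.
Proof.
elim: s => [|a s IH]; first by rewrite !big_nil expr0n mul0r.
rewrite !big_cons /= -natr1; set A := \sum_(x <- s) f x in IH *.
set Q := \sum_(x <- s) f x ^+ 2 in IH *.
have cross : 2 * f a * A <= Q + (size s)%:R * f a ^+ 2.
  rewrite /A /Q mulr_sumr; elim: s {IH A Q} => [|b s IH].
    by rewrite !big_nil mul0r addr0.
  rewrite !big_cons /= -natr1; have := sqr_ge0 (f a - f b); lra.
lra.
Qed.

End GeometricEstimates.

Lemma finite_argmax (T : choiceType) (d : Order.disp_t) (O : orderType d) (f : T -> O)
    (P : set T) : finite_set P -> P !=set0 ->
  exists2 x, P x & forall y, P y -> (f y <= f x)%O.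
Proof.
move=> Pfin [x0 Px0]; pose s := fset_set P.
have sP x : x \in s -> P x by rewrite in_fset_set // inE.
have Ps x : P x -> x \in s by move=> Px; rewrite in_fset_set // inE.
have x0s : x0 \in s by exact: Ps.
have [x _ xmax] := @Order.TotalTheory.arg_maxP _ _ s [` x0s]%fset xpredT (fun x : s => f (val x)) isT.
exists (val x); first exact/sP/valP.
by move=> y /Ps ys; exact: (xmax [` ys]%fset isT).
Qed.

(* A tree seen from an end: [par] moves one step towards the end, [lvl] is the
   Busemann function. *)
Record htree := HTree {
  hvertex :> choiceType;
  par : hvertex -> hvertex;
  ch : hvertex -> seq hvertex;
  lvl : hvertex -> int;
  deg : nat;
  mem_ch : forall x c, (c \in ch x) = (par c == x);
  ch_uniq : forall x, uniq (ch x);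
  size_ch : forall x, size (ch x) = deg;
  deg_gt1 : (1 < deg)%N;
  lvl_par : forall x, lvl (par x) = lvl x + 1 }.

Section Descendants.
Variable U : htree.
Implicit Types (x y c : U) (n : nat).

Fixpoint desc n x : seq U :=
  if n is n'.+1 then [seq c | y <- desc n' x, c <- ch y] else [:: x].

Lemma mem_desc n x y : (y \in desc n x) = (iter n (@par U) y == x).
Proof.
elim: n y => [|n IH] y; first by rewrite /= inE.
apply/allpairsPdep/eqP => [[z [c [zx cz ->]]]|yx].
  by move: zx cz; rewrite IH mem_ch iterSr => /eqP <- /eqP ->.
by exists (par y), y; rewrite IH mem_ch eqxx -iterSr yx eqxx.
Qed.

Lemma desc_uniq n x : uniq (desc n x).
Proof.
elim: n => //= n IH; apply: allpairs_uniq_dep => //; first by move=> ? _; exact: ch_uniq.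
move=> [y1 c1] [y2 c2] /allpairsPdep[y [c [_ yc [-> e1]]]] /allpairsPdep[y' [c' [_ yc' [-> e2]]]].
move: yc yc' e1 e2; rewrite !mem_ch => /eqP <- /eqP <-.
by move=> /= e1 e2 /= cc; subst.
Qed.

Lemma sum_desc (M : nmodType) (F : U -> M) n x :
  \sum_(c <- desc n.+1 x) F c = \sum_(y <- desc n x) \sum_(c <- ch y) F c.
Proof. by rewrite big_allpairs_dep. Qed.

Lemma size_desc n x : size (desc n x) = (deg U ^ n)%N.
Proof.
elim: n => //= n IH; rewrite size_allpairs_dep sumnE big_map.
by under eq_bigr do rewrite size_ch; rewrite big_const_seq count_predT IH iter_addn addn0 expnS.
Qed.

Lemma expn_size_desc n x : (2 ^ n <= size (desc n x))%N.
Proof. by rewrite size_desc; case: n => // n; rewrite leq_exp2r // deg_gt1. Qed.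

End Descendants.

(** * Averages over generations and across tetrahedra *)

Section Averages.
Variables (R : realType) (U V : htree).
Implicit Types (h f : U -> V -> R) (X : seq U) (Z : seq V).

(* Edges of the horocyclic product correspond to pairs [(c, z)]: such a pair
   stands for the edge from [(par c, z)] to [(c, par z)]. *)
Definition grad h (c : U) (z : V) : R := h c (par z) - h (par c) z.

Definition avg X Z f : R :=
  (\sum_(x <- X) \sum_(z <- Z) f x z) / ((size X)%:R * (size Z)%:R).

Lemma avgB X Z f g : avg X Z f - avg X Z g = avg X Z (fun x z => f x z - g x z).
Proof.
rewrite /avg -mulrBl -sumrB; congr (_ / _).
by apply: eq_bigr => x _; rewrite sumrB.
Qed.

Lemma deg_neq0 (W : htree) : (deg W)%:R != 0 :> R.
Proof. by rewrite pnatr_eq0 -lt0n ltnW // deg_gt1. Qed.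

(** All vertices have equally many children, so pulling a function back along [par] preserves its
    mean. Thus means over adjacent levels become means over the edges between them. *)
Lemma avg_par_l n a Z f :
  avg (desc n.+1 a) Z (fun c z => f (par c) z) = avg (desc n a) Z f.
Proof.
rewrite /avg sum_desc !size_desc expnS natrM -mulrA invfM mulrA; congr (_ / _).
rewrite mulr_suml; apply: eq_bigr => y _.
rewrite (eq_big_seq (fun=> \sum_(z <- Z) f y z)); last first.
  by move=> c; rewrite mem_ch => /eqP ->.
by rewrite big_const_seq count_predT size_ch iter_addr addr0 -(mulr_natr (\sum_(z <- Z) f y z)) mulfK // deg_neq0.
Qed.

Lemma avg_par_r n b X f :
  avg X (desc n.+1 b) (fun x z => f x (par z)) = avg X (desc n b) f.
Proof.
rewrite /avg [in LHS]exchange_big sum_desc [in RHS]exchange_big !size_desc expnS natrM.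
rewrite mulrCA [in LHS]invfM mulrA; congr (_ / _).
rewrite mulr_suml; apply: eq_bigr => y _.
rewrite (eq_big_seq (fun=> \sum_(x <- X) f x y)); last first.
  by move=> c; rewrite mem_ch => /eqP ->.
by rewrite big_const_seq count_predT size_ch iter_addr addr0 -(mulr_natr (\sum_(x <- X) f x y)) mulfK // deg_neq0.
Qed.

Lemma avg_sqr X Z f : (0 < size X)%N -> (0 < size Z)%N ->
  avg X Z f ^+ 2 <=
  (\sum_(p <- [seq (x, z) | x <- X, z <- Z]) f p.1 p.2 ^+ 2) / ((size X)%:R * (size Z)%:R).
Proof.
move=> X0 Z0; have S0 : (0 : R) < (size X)%:R * (size Z)%:R by rewrite mulr_gt0 // ltr0n.
rewrite ler_pdivlMr // /avg.
have sqE (S P : R) : 0 < P -> (S / P) ^+ 2 * P = S ^+ 2 / P.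
  by move=> P0; field; rewrite gt_eqF.
rewrite sqE // ler_pdivrMr // [X in _ <= X]mulrC -natrM -(size_allpairs (@pair U V)).
apply: le_trans (sqr_sum_le _ (fun p => f p.1 p.2)).
by rewrite big_allpairs_dep.
Qed.

Lemma avg_grad_le h X Z (c : R) n : uniq X -> uniq Z -> 0 <= c ->
  (2 ^ n <= size X * size Z)%N ->
  \sum_(p <- [seq (x, z) | x <- X, z <- Z]) grad h p.1 p.2 ^+ 2 <= c ->
  `|avg X Z (grad h)| <= Num.sqrt c * (3 / 4) ^+ n.
Proof.
move=> uX uZ c0 n_le Ec; apply: normr_le_sqrt => //.
have XZ0 : (0 < size X * size Z)%N by apply: leq_trans n_le; rewrite expn_gt0.
have [X0 Z0] : (0 < size X)%N /\ (0 < size Z)%N by apply/andP; rewrite -muln_gt0.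
apply: le_trans (avg_sqr _ X0 Z0) _; rewrite -natrM.
rewrite ler_pdivrMr ?ltr0n //; apply: le_trans Ec _.
rewrite -mulrA ler_peMr // mulrC ler_pdivlMr ?exprn_gt0 // mul1r -natrX ler_nat //.
Qed.

Lemma allpairs_pair_uniq X Z : uniq X -> uniq Z -> uniq [seq (x, z) | x <- X, z <- Z].
Proof. by move=> uX uZ; apply: allpairs_uniq => // -[? ?] [? ?] _ _ [-> ->]. Qed.

Variables (h : U -> V -> R) (E : R).
Hypothesis energy : forall S : seq (U * V), uniq S ->
  \sum_(p <- S) grad h p.1 p.2 ^+ 2 <= E.

Lemma energy_ge0 : 0 <= E.
Proof. by have := energy (isT : uniq [::]); rewrite big_nil. Qed.

Definition down_avg n (x : U) (z : V) : R := avg (desc n x) [:: iter n (@par V) z] h.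

Lemma down_avg0 x z : down_avg 0 x z = h x z.
Proof. by rewrite /down_avg /avg !big_seq1 mulr1 divr1. Qed.

Lemma down_avg_step n x z :
  down_avg n.+1 x z - down_avg n x z =
  avg (desc n.+1 x) [:: iter n (@par V) z] (grad h).
Proof.
rewrite -avgB avg_par_l; congr (_ - _).
by rewrite /down_avg /avg; congr (_ / _); apply: eq_bigr => c _; rewrite !big_seq1.
Qed.

(* The descendants of [a] and of [w] span a tetrahedron; the mean of [h] changes
   between consecutive levels by a mean of [grad h] over at least [2 ^ (i + j + k)] edges. *)
Lemma tetrahedron_le k i j a w :
  `|avg (desc (i + k) a) (desc j w) h - avg (desc i a) (desc (j + k) w) h|
  <= k%:R * (Num.sqrt E * (3 / 4) ^+ (i + j + k)).
Proof.
elim: k j => [|k IH] j; first by rewrite !addn0 subrr normr0 mul0r.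
have e2 : (i + j.+1 + k = i + j + k.+1)%N by rewrite addnS addSnnS.
have := IH j.+1; rewrite e2 addSnnS => {}IH.
have step : `|avg (desc (i + k).+1 a) (desc j w) h - avg (desc (i + k) a) (desc j.+1 w) h|
   <= Num.sqrt E * (3 / 4) ^+ (i + j + k.+1).
  rewrite -(avg_par_r _ _ _ h) -(avg_par_l _ _ _ h) avgB.
  apply: avg_grad_le; rewrite ?desc_uniq ?energy_ge0 //.
    rewrite addnAC expnD addnS; apply: leq_mul; first exact: expn_size_desc.
    by apply: leq_trans (expn_size_desc j.+1 w); rewrite leq_exp2l.
  by apply: energy; apply: allpairs_pair_uniq; exact: desc_uniq.
rewrite addnS -(subrKA (avg (desc (i + k) a) (desc j.+1 w) h)).
apply: le_trans (ler_normD _ _) _; rewrite -natr1 mulrDl mul1r addrC.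
exact: lerD.
Qed.

End Averages.

Lemma linear_geometric_vanish (R : realType) (x K K' : R) : 0 <= K -> 0 <= K' ->
  (forall n : nat, `|x| <= (K * n%:R + K') * (3 / 4) ^+ n) -> x = 0.
Proof.
move=> K0 K'0 xK; apply: (@geometric_vanish _ _ (5 * K + K')) => n.
apply: le_trans (xK n) _.
have -> : (9 / 10 : R) = (6 / 5) * (3 / 4) by lra.
rewrite [X in _ <= _ * X]exprMn [X in _ <= X]mulrA; apply: ler_wpM2r; first by rewrite exprn_ge0 //; lra.
have b1 : 1 <= (6 / 5) ^+ n :> R by apply: exprn_ege1; lra.
have := bernoulli_65 R n; nra.
Qed.

(** * Limits of the descending averages *)

Section Limits.
Variables (R : realType) (U V : htree) (h : U -> V -> R) (E : R).
Hypothesis energy : forall S : seq (U * V), uniq S ->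
  \sum_(p <- S) grad h p.1 p.2 ^+ 2 <= E.

Definition down_limit (C : U -> V -> R) :=
  forall n x z, `|down_avg h n x z - C x z| <= 4 * Num.sqrt E * (3 / 4) ^+ n.

Let E0 := energy_ge0 energy.
Let sE0 : 0 <= Num.sqrt E := sqrtr_ge0 E.
Let r0 n : 0 <= (3 / 4) ^+ n :> R. Proof. by apply: exprn_ge0; lra. Qed.

Lemma down_avg_step_le (e : R) n x z : 0 <= e ->
  \sum_(c <- desc n.+1 x) grad h c (iter n (@par V) z) ^+ 2 <= e ->
  `|down_avg h n.+1 x z - down_avg h n x z| <= Num.sqrt e * (3 / 4) ^+ n.
Proof.
move=> e0 He; rewrite down_avg_step; apply: avg_grad_le => //; first exact: desc_uniq.
  by rewrite muln1; apply: leq_trans (expn_size_desc n.+1 x); rewrite leq_exp2l.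
rewrite big_allpairs_dep; under eq_bigr do rewrite big_seq1; exact: He.
Qed.

Lemma level_energy n x z :
  \sum_(c <- desc n.+1 x) grad h c (iter n (@par V) z) ^+ 2 <= E.
Proof.
have := energy (allpairs_pair_uniq (desc_uniq n.+1 x) (isT : uniq [:: iter n (@par V) z])).
by rewrite big_allpairs_dep; under eq_bigr do rewrite big_seq1.
Qed.

Lemma down_limit_exists : exists C, down_limit C.
Proof.
have /choice[C CP] : forall p : U * V, exists c : R, forall n,
    `|down_avg h n p.1 p.2 - c| <= 4 * Num.sqrt E * (3 / 4) ^+ n.
  move=> [x z]; apply: (@geometric_limit _ (fun n => down_avg h n x z)) => n.
  by apply: down_avg_step_le => //; exact: level_energy.
by exists (fun x z => C (x, z)) => n x z; exact: (CP (x, z) n).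
Qed.

Variable C : U -> V -> R.
Hypothesis CP : down_limit C.

(** Summing the level steps with the energy [e] of this one descending tree gives a limit [c] within
    [4 * Num.sqrt e]. Limits of the same averages being unique, [c] is the value [C x z] obtained
    from the global bound [E]. *)
Lemma dist_limit_le (e : R) x z : 0 <= e ->
  (forall n, \sum_(c <- desc n.+1 x) grad h c (iter n (@par V) z) ^+ 2 <= e) ->
  `|h x z - C x z| <= 4 * Num.sqrt e.
Proof.
move=> e0 He.
have [c cP] := @geometric_limit _ (fun n => down_avg h n x z) (Num.sqrt e)
  (fun n => down_avg_step_le e0 (He n)).
suff <- : c = C x z by have := cP 0%N; rewrite expr0 mulr1 down_avg0.
apply/eqP; rewrite -subr_eq0; apply/eqP.
apply: (@linear_geometric_vanish _ _ 0 (4 * Num.sqrt e + 4 * Num.sqrt E)).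
- exact: lexx.
- by rewrite addr_ge0 ?mulr_ge0 ?sqrtr_ge0.
move=> n; rewrite mul0r add0r -(subrKA (down_avg h n x z)) mulrDl.
by apply: le_trans (ler_normD _ _) _; apply: lerD; [rewrite distrC; exact: cP|exact: CP].
Qed.

(** Here [x] stays fixed and [z] is replaced by all vertices with the same [n]-th ancestor: the
    bottom level, on the side of [V], of the tetrahedron whose other extreme level is averaged by
    [down_avg n x z]. *)
Definition side_avg n (x : U) (z : V) : R :=
  avg [:: x] (desc n (iter n (@par V) z)) h.

Lemma down_side_le n x z :
  `|down_avg h n x z - side_avg n x z| <= n%:R * (Num.sqrt E * (3 / 4) ^+ n).
Proof. exact: (tetrahedron_le energy n 0 0 x (iter n (@par V) z)). Qed.

Lemma side_limit_le n x z :
  `|side_avg n x z - C x z| <= (Num.sqrt E * n%:R + 4 * Num.sqrt E) * (3 / 4) ^+ n.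
Proof.
rewrite -(subrKA (down_avg h n x z)) mulrDl; apply: le_trans (ler_normD _ _) _.
apply: lerD; last exact: CP.
by rewrite distrC; apply: le_trans (down_side_le n x z) _; rewrite mulrA [_ * n%:R]mulrC.
Qed.

(** The side averages at the two ends of an edge, taken at depths [n] and [n.+1], see descendants of
    the same ancestor in [V]. They differ by a mean of [grad h] over edges [(c, z')] with [z'] in
    that generation. *)
Lemma limit_invariant c z : C c (par z) = C (par c) z.
Proof.
apply/eqP; rewrite -subr_eq0; apply/eqP.
(* The constant 10 collects 1 from the step [h3], 4 from the side limit at depth [n], and 5 from the
   one at depth [n.+1] after [h4]. *)
apply: (@linear_geometric_vanish _ _ (2 * Num.sqrt E) (10 * Num.sqrt E));
  rewrite ?mulr_ge0 // => n.
have h1 := side_limit_le n c (par z).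
have h2 := side_limit_le n.+1 (par c) z.
have h3 : `|side_avg n c (par z) - side_avg n.+1 (par c) z| <= Num.sqrt E * (3 / 4) ^+ n.
  rewrite /side_avg -iterSr.
  rewrite -(avg_par_r n _ [:: c] h) [X in _ - X](_ : _ =
     avg [:: c] (desc n.+1 (iter n.+1 (@par V) z)) (fun x z => h (par x) z)); last first.
    by rewrite /avg !big_seq1.
  rewrite avgB; apply: avg_grad_le; rewrite ?desc_uniq //.
    by rewrite mul1n; apply: leq_trans (expn_size_desc n.+1 _); rewrite leq_exp2l.
  by apply: energy; apply: allpairs_pair_uniq => //; exact: desc_uniq.
have h4 : (Num.sqrt E * n.+1%:R + 4 * Num.sqrt E) * (3 / 4) ^+ n.+1 <=
   (Num.sqrt E * n%:R + 5 * Num.sqrt E) * (3 / 4) ^+ n.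
  rewrite exprS mulrA; apply: ler_wpM2r => //; rewrite -natr1.
  have n0 : (0 : R) <= n%:R by [].
  have := mulr_ge0 sE0 n0; have := sE0; lra.
have -> : C c (par z) - C (par c) z =
    (side_avg n c (par z) - side_avg n.+1 (par c) z) -
    (side_avg n c (par z) - C c (par z)) + (side_avg n.+1 (par c) z - C (par c) z) by ring.
apply: le_trans (ler_normD _ _) _.
apply: le_trans (lerD (ler_normB _ _) (le_trans h2 h4)) _.
apply: le_trans (lerD (lerD h3 h1) (lexx _)) _.
by rewrite -!mulrDl; apply: ler_wpM2r => //; have := sE0; lra.
Qed.

Lemma limit_invariant_iter n c z : C c (iter n (@par V) z) = C (iter n (@par U) c) z.
Proof. by elim: n c => // n IH c; rewrite iterS limit_invariant IH iterSr. Qed.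

End Limits.

Section SwapLimits.
Variables (R : realType) (U V : htree) (h : U -> V -> R) (E : R).
Hypothesis energy : forall S : seq (U * V), uniq S ->
  \sum_(p <- S) grad h p.1 p.2 ^+ 2 <= E.
Let h' (z : V) (x : U) := h x z.

Lemma energy_swap (S : seq (V * U)) : uniq S -> \sum_(p <- S) grad h' p.1 p.2 ^+ 2 <= E.
Proof.
move=> uS; have inj : injective (fun p : V * U => (p.2, p.1)) by move=> [? ?] [? ?] [-> ->].
have := energy (etrans (map_inj_uniq inj S) uS); rewrite big_map.
by under eq_bigr do rewrite /grad -sqrrN opprB.
Qed.

(** Take an [n]-th descendant [y] of [x]. The descending average of [h'] at the [n]-th ancestor of
    [z] and [y] is the side average of [h] at [(x, z)], which is close to [C x z]; invariance along
    edges moves its limit to [C' z x]. *)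
Lemma limit_swap C C' : down_limit h E C -> down_limit h' E C' ->
  forall x z, C x z = C' z x.
Proof.
move=> CP C'P x z; apply/eqP; rewrite -subr_eq0; apply/eqP.
apply: (@linear_geometric_vanish _ _ (Num.sqrt E) (8 * Num.sqrt E));
  rewrite ?mulr_ge0 ?sqrtr_ge0 // => n.
have [y yx] : exists y, iter n (@par U) y = x.
  have := leq_trans (expn_gt0 2 n : 0 < _)%N (expn_size_desc n x).
  case E': (desc n x) => [//|y s] _; exists y; apply/eqP.
  by rewrite -mem_desc E' inE eqxx.
have := C'P n (iter n (@par V) z) y.
rewrite -(limit_invariant_iter energy_swap C'P) yx => h1.
have h2 := side_limit_le energy CP n x z.
have e : down_avg h' n (iter n (@par V) z) y = side_avg h n x z.
  rewrite /down_avg /side_avg /avg yx [X in _ / X]mulrC; congr (_ / _).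
  by rewrite exchange_big.
rewrite e in h1; rewrite -(subrKA (side_avg h n x z)).
apply: le_trans (ler_normD _ _) _; rewrite distrC.
by apply: le_trans (lerD h2 h1) _; rewrite -mulrDl; apply: ler_wpM2r;
  [apply: exprn_ge0|]; lra.
Qed.

End SwapLimits.

(** * Decay at infinity, the maximum principle and triviality *)

Lemma lvl_iter (U : htree) n (x : U) : lvl (iter n (@par U) x) = lvl x + n%:Z.
Proof. by elim: n => [|n IH]; rewrite ?addr0 // iterS lvl_par IH -addrA -addn1. Qed.

(** [S] is a finite set whose sum comes within [e] of the supremum over all finite sets. *)
Lemma energy_tail (R : realType) (T : choiceType) (f : T -> R) (E e : R) : 0 < e ->
  (forall x, 0 <= f x) -> (forall S : seq T, uniq S -> \sum_(p <- S) f p <= E) ->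
  exists S : seq T, forall S', uniq S' -> (forall p, p \in S' -> p \notin S) ->
    \sum_(p <- S') f p <= e.
Proof.
move=> e0 f0 fE; pose A := [set v | exists2 S : seq T, uniq S & v = \sum_(p <- S) f p].
have supA : has_sup A.
  split; first by exists 0, [::]; rewrite ?big_nil.
  by exists E => _ [S uS ->]; exact: fE.
have [_ [S uS ->] supS] := sup_adherent e0 supA.
exists S => S' uS' disj.
have : \sum_(p <- S ++ S') f p <= sup A.
  apply: ub_le_sup; first exact: supA.2.
  exists (S ++ S') => //; rewrite cat_uniq uS uS' andbT /=.
  by apply/hasPn => p /disj.
by rewrite big_cat /=; move: supS; lra.
Qed.

(* Edges [p], [q] of a finite set [S] below a vertex in the two descending trees
   determine the vertex up to the two distances, and these are bounded by levels. *)
Lemma finite_far_set (R : realType) (U V : htree) (h C : U -> V -> R) (E d : R) :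
  (forall S : seq (U * V), uniq S -> \sum_(p <- S) grad h p.1 p.2 ^+ 2 <= E) ->
  down_limit h E C -> 0 < d ->
  finite_set [set p : U * V | d <= `|h p.1 p.2 - C p.1 p.2|].
Proof.
(* With this choice [4 * Num.sqrt e] is [d / 2], so a descending tree of energy at most [e] keeps
   [h] closer than [d] to its limit. *)
move=> energy CP d0; pose e := (d / 8) ^+ 2.
have e0 : 0 < e by apply: exprn_gt0; lra.
have se : 4 * Num.sqrt e < d by rewrite sqrtr_sqr ger0_norm; lra.
have [C' C'P] := down_limit_exists (energy_swap energy).
have CC' := limit_swap energy CP C'P.
have [S Stail] := energy_tail e0 (fun p => sqr_ge0 (grad h p.1 p.2)) energy.
pose N1 (pq : (U * V) * (U * V)) := `|lvl pq.2.1 - lvl pq.1.1|%N.+1.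
pose N2 (pq : (U * V) * (U * V)) := `|lvl pq.1.2 - lvl pq.2.2|%N.+1.
pose F (pq : (U * V) * (U * V)) (ij : nat * nat) :=
  (iter ij.1 (@par U) pq.1.1, iter ij.2 (@par V) pq.2.2).
pose s := [seq F pq ij | pq <- [seq (p, q) | p <- S, q <- S],
  ij <- [seq (i, j) | i <- iota 0 (N1 pq), j <- iota 0 (N2 pq)]].
apply: (@sub_finite_set _ _ [set` s]); last exact: finite_seq.
move=> [x z] /= far.
(* A descending tree at [(x, z)] that avoids [S] has energy at most [e], contradicting [far]; the
   same is done below in the other tree. *)
have [n [p pS [pn pz]]] : exists n, exists2 p, p \in S &
    iter n.+1 (@par U) p.1 = x /\ p.2 = iter n (@par V) z.
  apply: contrapT => no; have : `|h x z - C x z| <= 4 * Num.sqrt e; last by lra.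
  apply: (dist_limit_le CP) => [|n]; first exact: ltW.
  have := Stail [seq (c, w) | c <- desc n.+1 x, w <- [:: iter n (@par V) z]].
  rewrite big_allpairs_dep; under eq_bigr do rewrite big_seq1.
  apply; first by apply: allpairs_pair_uniq => //; exact: desc_uniq.
  move=> p /allpairsP[[c w] [cx wz ->]] /=; apply/negP => pS; apply: no.
  exists n, (c, w) => //=; split; first by move: cx; rewrite mem_desc => /eqP.
  by apply/eqP; rewrite inE in wz.
have [m [q qS [qm qx]]] : exists m, exists2 q, q \in S &
    iter m.+1 (@par V) q.2 = z /\ q.1 = iter m (@par U) x.
  apply: contrapT => no; have : `|h x z - C x z| <= 4 * Num.sqrt e; last by lra.
  rewrite CC'.
  apply: (dist_limit_le C'P) => [|n']; first exact: ltW.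
  have := Stail [seq (w, c) | w <- [:: iter n' (@par U) x], c <- desc n'.+1 z].
  rewrite big_allpairs_dep big_seq1.
  under eq_bigr do rewrite /grad -sqrrN opprB.
  apply; first by apply: allpairs_pair_uniq => //; exact: desc_uniq.
  move=> p' /allpairsP[[w c] [wx cz ->]] /=; apply/negP => p'S; apply: no.
  exists n', (w, c) => //=; split; first by move: cz; rewrite mem_desc => /eqP.
  by apply/eqP; rewrite inE in wx.
have e1 : lvl q.1 = lvl p.1 + (m + n.+1)%N by rewrite qx -pn -iterD lvl_iter.
have e2 : lvl p.2 = lvl q.2 + (n + m.+1)%N by rewrite pz -qm -iterD lvl_iter.
have -> : (x, z) = F (p, q) (n.+1, m.+1) by rewrite -pn -qm.
apply: allpairs_f_dep; first exact: allpairs_f.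
apply: allpairs_f; rewrite mem_iota /= add0n /N1 /N2 /=.
  by rewrite e1 addrC addKr /= ltnS leq_addl.
by rewrite e2 addrC addKr /= ltnS leq_addl.
Qed.

(** The graph Laplacian of the horocyclic product vanishes: the neighbours of [(x, z)] descend in
    one tree and ascend in the other. It is imposed for every value of [lvl x + lvl z], which edges
    preserve. *)
Definition horo_harmonic (R : realType) (U V : htree) (k : U -> V -> R) :=
  forall x z, \sum_(c <- ch x) (k x z - k c (par z)) +
    \sum_(c <- ch z) (k x z - k (par x) c) = 0.

(** A positive value would give a maximum attained on a finite set. Choose a maximizer with the
    highest level in [U]: harmonicity makes its neighbour one step closer to the end of [U] a
    maximizer too, a contradiction. *)
Lemma maximum_principle (R : realType) (U V : htree) (k : U -> V -> R) :
  horo_harmonic k ->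
  (forall d, 0 < d -> finite_set [set p : U * V | d <= k p.1 p.2]) ->
  forall x z, k x z <= 0.
Proof.
move=> harm fin x z; rewrite leNgt; apply/negP => k0.
have finP := fin _ k0; set P := [set p : U * V | _] in finP.
have [m Pm mmax] := finite_argmax (fun p => k p.1 p.2) finP (ex_intro _ (x, z) (lexx _)).
have {}mmax p : k p.1 p.2 <= k m.1 m.2.
  have [Pp|nPp] := boolP (k x z <= k p.1 p.2); first exact: mmax.
  by apply: le_trans Pm; rewrite ltW // ltNge.
pose Q := [set p : U * V | k p.1 p.2 = k m.1 m.2].
have finQ : finite_set Q by apply: sub_finite_set finP => p /= pm; rewrite /P /= pm; exact: Pm.
have [p Qp pmax] := finite_argmax (fun p : U * V => lvl p.1) finQ (ex_intro _ m erefl).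
have [c cp] : exists c, c \in ch p.2.
  have := ltnW (deg_gt1 V); rewrite -(size_ch p.2).
  by case: (ch p.2) => // c s _; exists c; rewrite inE eqxx.
suff /pmax : Q (par p.1, c) by rewrite /= lvl_par -[X in _ <= X]addr0 lerD2l.
have kp q : 0 <= k p.1 p.2 - k q.1 q.2 by rewrite subr_ge0 Qp mmax.
have s1 : 0 <= \sum_(c <- ch p.1) (k p.1 p.2 - k c (par p.2)).
  by apply: sumr_ge0 => c' _; exact: (kp (c', par p.2)).
have s2 : 0 <= \sum_(c <- ch p.2) (k p.1 p.2 - k (par p.1) c).
  by apply: sumr_ge0 => c' _; exact: (kp (par p.1, c')).
have /eqP : \sum_(c <- ch p.2) (k p.1 p.2 - k (par p.1) c) = 0.
  by have := harm p.1 p.2; lra.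
rewrite psumr_eq0; last by move=> c' _; exact: (kp (par p.1, c')).
by move=> /allP/(_ c cp); rewrite /= subr_eq0 => /eqP ek; rewrite /Q /= -ek; exact: Qp.
Qed.

(** Equality of [C] at the two ends of each edge suffices to make [h - C] harmonic. The maximum
    principle applies to it and to its negative, so [h = C] and the gradient vanishes. *)
Theorem harmonic_dirichlet_trivial (R : realType) (U V : htree) (h : U -> V -> R) (E : R) :
  (forall S : seq (U * V), uniq S -> \sum_(p <- S) grad h p.1 p.2 ^+ 2 <= E) ->
  horo_harmonic h -> forall c z, grad h c z = 0.
Proof.
move=> energy harm; have [C CP] := down_limit_exists energy.
have Cinv := limit_invariant energy CP.
pose k x z := h x z - C x z.
have kharm : horo_harmonic k.
  move=> x z; rewrite -[RHS](harm x z); congr (_ + _); apply: eq_big_seq => c;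
    rewrite mem_ch /k => /eqP cE.
    by rewrite Cinv cE; ring.
  by rewrite -Cinv cE; ring.
have kN : horo_harmonic (fun x z => - k x z).
  move=> x z; have /(congr1 -%R) := kharm x z; rewrite oppr0 opprD -!sumrN.
  apply: etrans.
  by congr (_ + _); apply: eq_bigr => c _; ring.
have k0 x z : k x z = 0.
  apply/eqP; rewrite eq_le; apply/andP; split.
    apply: (maximum_principle kharm) => d d0.
    apply: sub_finite_set (finite_far_set energy CP d0) => p /= dp.
    exact: le_trans dp (ler_norm _).
  rewrite -oppr_le0; apply: (maximum_principle kN) => d d0.
  apply: sub_finite_set (finite_far_set energy CP d0) => p /= dp.
  by apply: le_trans dp _; rewrite -normrN ler_norm.
move=> c z; have hC x y : h x y = C x y by have := k0 x y; rewrite /k; lra.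
by rewrite /grad !hC Cinv subrr.
Qed.

(** * Trees seen from an end *)

Section TreeEnd.
Variables (G : sgraph) (xi : set (nat -> G)) (o : G).
Hypothesis G_tree : is_tree G.
Hypothesis xi_end : is_end xi.
Implicit Types (x y v : G) (s : nat -> G).

Definition joined_avoiding v x y :=
  exists p : seq G, [/\ path (@adj G) x p, last x p = y & v \notin x :: p].

Lemma joined_trans v y x z :
  joined_avoiding v x y -> joined_avoiding v y z -> joined_avoiding v x z.
Proof.
move=> [p [xp py vp]] [q [yq qz vq]]; exists (p ++ q).
rewrite cat_path last_cat py xp yq; split=> //.
move: vp vq; rewrite !inE mem_cat !negb_or => /andP[-> ->] /andP[_ ->] //.
Qed.

Lemma joined_step v x y : adj x y -> v != x -> v != y -> joined_avoiding v x y.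
Proof.
by move=> xy vx vy; exists [:: y]; rewrite /= xy !inE negb_or vx vy.
Qed.

Lemma joined_sym v x y : joined_avoiding v x y -> joined_avoiding v y x.
Proof.
move=> [p [xp <-]]; elim: p x xp => [|z p IH] x /=; first by exists [::].
move=> /andP[xz zp]; rewrite !inE !negb_or => /andP[vx /andP[vz vp]].
have jzx : joined_avoiding v z x by apply: joined_step; rewrite // adj_sym.
by apply: joined_trans jzx; apply: IH => //; rewrite inE negb_or vz.
Qed.

(** A path between the two neighbours, shortened to a simple one, would close a cycle through [v].
    This replaces uniqueness of paths in all that follows. *)
Lemma neighbors_separated v x y : adj v x -> adj v y -> x != y ->
  ~ joined_avoiding v x y.
Proof.
move=> vx vy xy [p [xp py vp]].
case/shortenP: xp py vp => p' xp' up' sub py' vp.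
have [_] := G_tree; move/(_ [:: v, x & p']); apply.
  by case: p' py' {xp' up' sub} => //= yx; rewrite yx eqxx in xy.
apply/andP; split; last first.
  rewrite cons_uniq up' andbT; apply: contra vp; rewrite !inE => /orP[->//|/sub ->].
  by rewrite orbT.
by rewrite /= vx rcons_path xp' py' /= adj_sym.
Qed.

Lemma ray_joined s v i n : is_ray s -> (forall k, v != s (i + k)%N) ->
  joined_avoiding v (s i) (s (i + n)%N).
Proof.
move=> [_ sadj] vs; elim: n => [|n IH].
  by rewrite addn0; exists [::]; rewrite /= inE -[i]addn0 vs.
apply: joined_trans IH _; rewrite addnS; apply: joined_step => //.
by rewrite -addnS.
Qed.

Lemma end_ray s : xi s -> is_ray s.
Proof. by have [r _ ->] := xi_end => -[]. Qed.

Lemma end_tail s s' : xi s -> xi s' -> tail_equiv s s'.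
Proof.
have [r _ ->] := xi_end => -[_ [m [n mn]]] [_ [m' [n' mn']]].
exists (n + m')%N, (n' + m)%N => k.
by rewrite -!addnA -mn -mn' !addnA [(m + m')%N]addnC.
Qed.

Lemma end_closed s s' : xi s -> is_ray s' -> tail_equiv s s' -> xi s'.
Proof.
have [r _ ->] := xi_end => -[_ [m [n mn]]] rs' [m' [n' mn']]; split=> //.
exists (m + m')%N, (n' + n)%N => k.
by rewrite -!addnA mn addnCA mn'.
Qed.

(** Where the rays first part, their next vertices are distinct neighbours of [s i], yet they are
    joined through the common tail without returning to [s i]. *)
Lemma end_unique s s' : xi s -> xi s' -> s 0%N = s' 0%N -> s = s'.
Proof.
move=> xs xs' s0; apply/funext; elim=> // i si.
have [rs rs'] := (end_ray xs, end_ray xs').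
apply/eqP/negPn/negP => ne.
have [m [n mn]] := end_tail xs xs'.
apply: (@neighbors_separated (s i) (s i.+1) (s' i.+1)) => //.
- exact: rs.2.
- by rewrite si; exact: rs'.2.
have av (t : nat -> G) k : is_ray t -> t i != t (i.+1 + k)%N.
  by move=> [ti _]; apply/eqP => /ti/eqP; rewrite addSn -addnS -[X in X == _]addn0 eqn_add2l.
apply: (joined_trans (y := s (i.+1 + m)%N)); first by apply: ray_joined => // k; exact: av.
have -> : s (i.+1 + m)%N = s' (i.+1 + n)%N by rewrite addnC mn addnC.
by apply: joined_sym; apply: ray_joined => // k; rewrite si; exact: av.
Qed.

Lemma is_ray_shift s n : is_ray s -> is_ray (fun k => s (n + k)%N).
Proof.
move=> [si sadj]; split=> [i j /si/eqP|i]; first by rewrite eqn_add2l => /eqP.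
by rewrite addnS.
Qed.

Lemma end_shift s n : xi s -> xi (fun k => s (n + k)%N).
Proof.
move=> xs; apply: (end_closed xs); first exact/is_ray_shift/end_ray.
by exists n, 0%N.
Qed.

Lemma end_cons s y : xi s -> adj y (s 0%N) -> (forall n, s n <> y) ->
  xi (fun k => if k is k'.+1 then s k' else y).
Proof.
move=> xs ys yn; have [si sadj] := end_ray xs; apply: (end_closed xs); last by exists 0%N, 1%N.
split=> [[|i] [|j]//|[|i]//]; first by move=> /esym/yn.
  by move=> /yn.
by move=> /si ->.
Qed.

(** Follow a path from the origin of some representative to [x]: at each step the new vertex either
    lies on the current ray, which is then shortened, or can be prepended to it. *)
Lemma end_from x : exists2 s, xi s & s 0%N = x.
Proof.
have [r rr xiE] := xi_end.
have xr : xi r by rewrite xiE; split=> //; exists 0%N, 0%N.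
have [/(_ (r 0%N) x)[p [rp <-]] _] := G_tree.
suff gen z : (exists2 s, xi s & s 0%N = z) -> path (@adj G) z p ->
    exists2 s, xi s & s 0%N = last z p by apply: gen rp; exists r.
elim: p z {rp} => //= y p IH z [s xs s0] /andP[zy yp]; apply: IH yp.
have [[n sn]|/forallNP ny] := pselect (exists n, s n = y).
  by exists (fun k => s (n + k)%N); rewrite ?addn0 //; exact: end_shift.
by exists (fun k => if k is k'.+1 then s k' else y) => //; apply: end_cons; rewrite // s0 adj_sym.
Qed.

Lemma eta_end x : xi (Defs.eta xi x) /\ Defs.eta xi x 0%N = x.
Proof.
have [s xs s0] := end_from x.
by apply: (@xgetPex _ (fun=> x) [set r | xi r /\ r 0%N = x]); exists s.
Qed.

Definition tree_par x : G := Defs.eta xi x 1%N.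

Lemma eta_iter x n : Defs.eta xi x n = iter n tree_par x.
Proof.
elim: n x => [|n IH] x; first by have [] := eta_end x.
rewrite iterSr -IH; have [xe e0] := eta_end x; have [xe' e0'] := eta_end (tree_par x).
by rewrite (end_unique xe' (end_shift 1 xe)) // e0'.
Qed.

Lemma iter_par_inj x m n : iter m tree_par x = iter n tree_par x -> m = n.
Proof. by rewrite -!eta_iter; apply: (end_ray (eta_end x).1).1. Qed.

Lemma adj_par x : adj x (tree_par x).
Proof.
have [xe e0] := eta_end x; have := (end_ray xe).2 0%N.
by rewrite -/(tree_par x) e0.
Qed.

Lemma par_meet x y : exists m n, iter m tree_par x = iter n tree_par y.
Proof.
have [m [n mn]] := end_tail (eta_end x).1 (eta_end y).1.
by exists m, n; rewrite -!eta_iter -[m]addn0 -[n]addn0.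
Qed.

(** If [y] lies on the ray from [x], separation at [x] forces it to be the next vertex. Otherwise
    [y] followed by that ray is the ray of [y], so its parent is [x]. *)
Lemma adj_parP x y : adj x y <-> tree_par x = y \/ tree_par y = x.
Proof.
split=> [xy|[<-|<-]]; [|exact: adj_par|by rewrite adj_sym adj_par].
have [xe e0] := eta_end x; have [[n sn]|/forallNP ny] := pselect (exists n, Defs.eta xi x n = y).
  left; apply/eqP/negPn/negP => ne.
  apply: (neighbors_separated (adj_par x) xy ne).
  case: n sn => [sn|n]; first by rewrite -sn e0 adj_irr in xy.
  rewrite -add1n => <-; apply: ray_joined; first exact: end_ray.
  move=> k; rewrite -[X in X != _]e0; apply/eqP => /(end_ray xe).1.
  by [].
right; have ys : adj y (Defs.eta xi x 0%N) by rewrite e0 adj_sym.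
have xc := end_cons xe ys ny.
by rewrite /tree_par (end_unique (eta_end y).1 xc) // (eta_end y).2.
Qed.

Lemma least_eq (P : set nat) n : P n -> (forall m, P m -> (n <= m)%N) -> least P = n.
Proof.
move=> Pn nmin.
have [P' lmin] : [set n | P n /\ forall m, P m -> (n <= m)%N] (least P).
  by apply: xgetPex; exists n.
apply/eqP; rewrite eqn_leq lmin //=.
exact: nmin.
Qed.

Lemma leastP (P : set nat) : P !=set0 -> P (least P).
Proof.
move=> [n Pn]; have ex : exists n, `[< P n >] by exists n; apply/asboolP.
have := ex_minnP ex; case=> m /asboolP Pm mmin.
by rewrite (@least_eq _ m) // => k Pk; apply: mmin; apply/asboolP.
Qed.

(** The Busemann function computed from any common ancestor of [x] and [o]; the difference does not
    depend on the choice, which spares locating the first meeting vertex. *)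
Definition height x : int :=
  let mn := xget (0%N, 0%N) [set mn | iter mn.1 tree_par x = iter mn.2 tree_par o] in
  mn.2%:Z - mn.1%:Z.

Lemma heightE x m n : iter m tree_par x = iter n tree_par o -> height x = n%:Z - m%:Z.
Proof.
move=> mn; rewrite /height; set mn' := xget _ _.
have mn'E : iter mn'.1 tree_par x = iter mn'.2 tree_par o.
  by apply: (@xgetPex _ _ [set mn | iter mn.1 tree_par x = iter mn.2 tree_par o]); exists (m, n).
have /iter_par_inj : iter (mn'.1 + n)%N tree_par o = iter (m + mn'.2)%N tree_par o.
  by rewrite iterD -mn -iterD addnC iterD mn'E -iterD.
by move=> e; lia.
Qed.

Lemma height_par x : height (tree_par x) = height x + 1.
Proof.
have [m [n mn]] := par_meet x o.
rewrite (heightE mn) (@heightE _ m n.+1); first lia.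
by rewrite -iterSr !iterS mn.
Qed.

Lemma height_path x p : path (@adj G) x p -> (`|height (last x p) - height x| <= size p)%N.
Proof.
elim: p x => [|y p IH] x /=; first by rewrite subrr.
move=> /andP[/adj_parP xy /IH]; case: xy => <-; rewrite height_par; lia.
Qed.

(** The height changes by exactly one along each edge, so no path can climb [n] levels in fewer than
    [n] steps. *)
Lemma gdist_iter x n : gdist x (iter n tree_par x) = n.
Proof.
apply: least_eq => [|_ [p [xp px <-]]].
  exists [seq iter k tree_par x | k <- iota 1 n]; split.
  - suff gen i : path (@adj G) (iter i tree_par x) [seq iter k tree_par x | k <- iota i.+1 n].
      exact: (gen 0%N).
    by elim: n i => //= n IH i; rewrite adj_par; exact: (IH i.+1).
  - by case: n => // n; rewrite -[in iota _ _](addn1 n) iotaD map_cat last_cat.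
  - by rewrite size_map size_iota.
have := height_path xp; rewrite px.
have -> : height (iter n tree_par x) = height x + n%:Z.
  by elim: n {px} => [|n IH]; rewrite ?addr0 // iterS height_par IH; lia.
lia.
Qed.

Lemma busemannE x : busemann o xi x = height x.
Proof.
pose P := [set n | range (Defs.eta xi o) (Defs.eta xi x n)].
have [k _ kn] : range (Defs.eta xi o) (Defs.eta xi x (least P)) .
  apply: (@leastP P); have [m [n mn]] := par_meet x o.
  by exists m; exists n => //; rewrite !eta_iter.
have -> : busemann o xi x = (gdist o (Defs.eta xi x (least P)))%:Z - (gdist x (Defs.eta xi x (least P)))%:Z by [].
rewrite -[in gdist o _]kn !eta_iter !gdist_iter.
by rewrite (@heightE x (least P) k) // -!eta_iter.
Qed.

Variable b : nat.
Hypothesis b_ge2 : (2 <= b)%N.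
Hypothesis G_reg : regular b.+1 G.

Lemma finite_adj x : finite_set [set y | adj x y].
Proof. by apply/finite_setP; exists b.+1; exact: G_reg. Qed.

Definition children x : seq G := rem (tree_par x) (fset_set [set y | adj x y]).

Lemma mem_children x c : (c \in children x) = (tree_par c == x).
Proof.
rewrite mem_rem_uniq ?fset_uniq // inE /= in_fset_set; last exact: finite_adj.
apply/andP/eqP => [[cx /set_mem/adj_parP[xc|//]]|<-].
  by rewrite -xc eqxx in cx.
split; last by apply/mem_set; rewrite /= adj_sym adj_par.
apply/eqP => cE; have /iter_par_inj : iter 0 tree_par c = iter 2 tree_par c by [].
by [].
Qed.

(** Kept transparent so that [lvl] unfolds to [busemann] and pairs of total level 0 are, by
    conversion, vertices of [DL]. *)
Definition end_htree : htree.
Proof.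
refine (@HTree G tree_par children (busemann o xi) b mem_children _ _ b_ge2 _).
- by move=> x; apply: rem_uniq; exact: fset_uniq.
- move=> x; rewrite size_rem; first by rewrite (card_fset_set (G_reg x)).
  rewrite in_fset_set; last exact: finite_adj.
  by apply/mem_set; exact: adj_par.
- by move=> x; rewrite !busemannE height_par.
Defined.

End TreeEnd.

(** * Measures on edge configurations *)

(** Otherwise there are configurations outside [U] agreeing with [w] on each [F_ n]; they converge
    pointwise to [w], which contradicts openness. *)
Lemma cylinder_nbhs (E : choiceType) (F_ : nat -> {fset E}) (w : {ptws E -> bool})
    (U : set {ptws E -> bool}) :
  (forall n, (F_ n `<=` F_ n.+1)%fset) -> (forall e, exists n, e \in F_ n) ->
  open U -> U w ->
  exists n, forall w' : {ptws E -> bool}, (forall e, e \in F_ n -> w' e = w e) -> U w'.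
Proof.
move=> Fmono Fcov Uo Uw; apply: contrapT => /forallNP no.
have /choice[u uP] : forall n, exists w' : {ptws E -> bool},
    (forall e, e \in F_ n -> w' e = w e) /\ ~ U w'.
  move=> n; have /existsNP[w' /not_implyP[? ?]] := no n; by exists w'.
have Fle m n : (m <= n)%N -> (F_ m `<=` F_ n)%fset.
  move=> /subnKC <-; elim: (n - m)%N => [|k IH]; first by rewrite addn0.
  by rewrite addnS; apply: fsubset_trans IH (Fmono _).
have cv : u @ \oo --> w.
  rewrite cvg_sup => e; rewrite cvg_image; last first.
    by rewrite eqEsubset; split=> v // _; exists (cst v).
  have [m em] := Fcov e.
  have eveq : \forall n \near \oo, u n e = w e.
    exists m => // n /= mn; apply: (uP n).1; exact: (fsubsetP (Fle _ _ mn)).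
  move=> W Ww; exists ((fun f : E -> bool => f e) @^-1` W) => /=.
    apply: filterS eveq => n une; rewrite /= une; exact: nbhs_singleton.
  by rewrite eqEsubset; split => [j [? + <-//]|j Wj]; exists (fun _ => j).
have : \forall n \near \oo, U (u n) by apply: cv; exact: open_nbhs_nbhs.
by move=> [N _ /(_ N (leqnn N))]; exact: (uP N).2.
Qed.

Section Cylinders.
Variables (G : sgraph) (R : realType).
Implicit Types F : {fset edge G}.

Definition avoid F : set (config G) := [set w | forall e, e \in F -> w e = false].

(** The indicator of [avoid F] written as a finite product of coordinate functions, which shows it
    to be a continuous test function for weak convergence. *)
Definition avoid_fun F (w : config G) : R := \prod_(e <- F) (~~ w e)%:R.

Lemma avoid_funE F w : avoid_fun F w = \1_(avoid F) w.
Proof.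
rewrite indicE /avoid_fun; have [|] := boolP (w \in avoid F).
  rewrite inE /= => wF; rewrite big_seq big1 // => e /wF ->; by [].
rewrite notin_setE => wF; apply/eqP; rewrite prodf_seq_eq0.
have /existsNP[e /not_implyP[eF we]] := wF.
by apply/hasP; exists e => //=; case: (w e) we.
Qed.

Lemma coord_continuous (e : edge G) : continuous (fun w : config G => w e).
Proof. exact: (@proj_continuous (edge G) (fun=> bool) e). Qed.

Lemma avoid_fun_continuous F : continuous (avoid_fun F).
Proof.
rewrite /avoid_fun; elim: (F : seq _) => [|e s IH] w.
  by under eq_fun do rewrite big_nil; apply: cvg_cst.
under eq_fun do rewrite big_cons; apply: cvgM; last exact: IH.
have near_w : \forall w' \near w, w' e = w e.
  have /(_ [set w e]) := @coord_continuous e w; apply.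
  by apply: open_nbhs_nbhs; split => //; exact: discrete_open.
by apply: cvg_near_cst; apply: filterS near_w => w' ->.
Qed.

Lemma avoid_fun_bounded F : [bounded avoid_fun F x | x in setT].
Proof.
exists 1; split=> // M M1 w _ /=; rewrite avoid_funE indicE.
by case: (_ \in _); rewrite ?normr1 ?normr0 ltW // (lt_trans _ M1).
Qed.

Lemma avoid_open F : open (avoid F).
Proof.
have -> : avoid F = avoid_fun F @^-1` [set x | 2^-1 < x].
  apply/seteqP; split=> w /=; rewrite avoid_funE indicE.
    by move=> wF; rewrite mem_set // invf_lt1 // ltr1n.
  by have [|] := boolP (w \in avoid F); [rewrite inE|rewrite ltNge invr_ge0 ler0n].
by apply: open_comp; [move=> w _; exact: avoid_fun_continuous|exact: open_gt].
Qed.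

Lemma avoid_measurable F : measurable (avoid F : set (borel (config G))).
Proof. by apply: sub_sigma_algebra; exact: avoid_open. Qed.

Lemma integral_avoid_fun (mu : {measure set (borel (config G)) -> \bar R}) F :
  (\int[mu]_x (avoid_fun F x)%:E)%E = mu (avoid F).
Proof.
under eq_integral do rewrite avoid_funE.
by rewrite integral_indic ?setIT //; exact: avoid_measurable.
Qed.

Lemma avoidU F F' : avoid (F `|` F')%fset = avoid F `&` avoid F'.
Proof.
apply/seteqP; split=> [w wFF|w [wF wF'] e].
  by split=> e eF; apply: wFF; rewrite inE eF ?orbT.
by rewrite inE => /orP[/wF|/wF'].
Qed.

Lemma avoid0 : avoid fset0 = setT.
Proof. by apply/seteqP; split. Qed.

(** The avoidance events form a pi-system. They generate all open sets, because an open set is the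
    countable union over [n] of the finitely many cylinders on [F_ n] that it contains. *)
Lemma avoid_determines (F_ : nat -> {fset edge G})
    (mu nu : probability (borel (config G)) R) :
  (forall n, (F_ n `<=` F_ n.+1)%fset) -> (forall e, exists n, e \in F_ n) ->
  (forall F, mu (avoid F) = nu (avoid F)) ->
  forall A, measurable A -> mu A = nu A.
Proof.
move=> Fmono Fcov mn A mA.
pose GA : set (set (borel (config G))) := range avoid.
apply: (@g_sigma_algebra_measure_unique _ _ _ GA _ (fun=> setT)) => //.
- by move=> _ [F _ <-]; exact: avoid_measurable.
- by move=> _; exists fset0 => //; exact: avoid0.
- by apply/seteqP; split=> // w _; exists 0%N.
- by move=> _ _ [F _ <-] [F' _ <-]; exists (F `|` F')%fset => //; exact: avoidU.
- by move=> _ [F _ <-]; exact: mn.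
- by move=> k; apply: le_lt_trans (probability_le1 mu _) _; rewrite ?ltry //; exact: measurableT.
have subA : <<s GA >> `<=` <<s GA >> by [].
suff : @open (config G) `<=` <<s GA >>.
  by move=> oG; apply: smallest_sub mA => //; exact: smallest_sigma_algebra.
move=> U Uo.
pose GT : measurableType GA.-sigma := g_sigma_algebraType GA.
pose cyl (n : nat) (S : {fset edge G}) : set (config G) :=
  [set w | forall e, e \in F_ n -> w e = (e \in S)].
have mcoord e b : measurable ([set w | w e = b] : set GT).
  have m0 : measurable ([set w | w e = false] : set GT).
    apply: sub_sigma_algebra; exists [fset e]%fset => //.
    apply/seteqP; split=> w /=; first by apply; rewrite inE.
    by move=> we e'; rewrite inE => /eqP ->.
  case: b => //; rewrite (_ : [set w | _] = ~` [set w : GT | w e = false]).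
    exact: measurableC.
  by apply/seteqP; split=> w /=; case: (w e).
have mcyl n S : measurable (cyl n S : set GT).
  have -> : cyl n S = \big[setI/setT]_(e <- F_ n) [set w | w e = (e \in S)].
    apply/seteqP; split=> w; rewrite -bigcap_seq /=.
      by move=> wS e /= eF; exact: wS.
    by move=> wS e eF; exact: wS.
  by apply: bigsetI_measurable => e _; exact: mcoord.
have -> : U = \bigcup_n \big[setU/set0]_(S <- fpowerset (F_ n) | `[< cyl n S `<=` U >]) cyl n S.
  apply/seteqP; split=> [w Uw|w [n _]]; last first.
    rewrite -bigcup_seq_cond => -[S /= /andP[_ /asboolP SU]]; exact: SU.
  have [n nU] := cylinder_nbhs Fmono Fcov Uo Uw.
  exists n => //; rewrite -bigcup_seq_cond; exists [fset e in F_ n | w e]%fset => /=.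
    apply/andP; split.
      by rewrite fpowersetE; apply/fsubsetP => e; rewrite !inE => /andP[].
    by apply/asboolP => w' w'S; apply: nU => e eF; rewrite w'S // !inE eF.
  by move=> e eF; rewrite !inE eF.
apply: (@bigcupT_measurable _ GT) => n.
by apply: bigsetU_measurable => S _; exact: mcyl.
Qed.

Lemma uniform_measure_card (S A : set (config G)) (n0 n1 : nat) :
  (S #= `I_n0)%card -> (S `&` A #= `I_n1)%card ->
  uniform_measure R S A = (n1%:R / n0%:R)%:E.
Proof.
move=> S0 S1; rewrite /uniform_measure /= /mscale /msum /=.
have Sfin : finite_set S by apply/finite_setP; exists n0.
set s := fset_set S; have sn : #|` s| = n0 := card_fset_set S0.
have -> : msum (fun k : nat => \d_(nth point s k : borel (config G))) #|` s| A =
    (\sum_(k < #|` s|) (nth point s k \in A)%:R%:E)%E :> \bar R.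
  by apply: eq_bigr => k _; exact: diracE.
rewrite sumEFin -(big_mkord xpredT (fun k => (nth point s k \in A)%:R)) -EFinM.
rewrite -(big_nth point xpredT (fun x => (x \in A)%:R)) sn mulrC; congr (_ / _)%:E.
rewrite -natr_sum; congr (_%:R); rewrite -(card_fset_set S1).
have -> : fset_set (S `&` A) = [fset x in s | x \in A]%fset.
  apply/fsetP => x; rewrite in_fset_set; last exact: finite_setIl.
  by rewrite !inE /= in_fset_set // in_setI.
transitivity (size [seq x <- s | x \in A]).
  by rewrite size_filter -sum1_count [RHS]big_mkcond; apply: eq_bigr => x _; case: (x \in A).
apply: perm_size; apply: uniq_perm; rewrite ?filter_uniq ?fset_uniq // => x.
by rewrite mem_filter !inE /= andbC.
Qed.

Lemma integral_UST_avoid (W : choiceType) (M : mgraph W (edge G)) F (n0 n1 : nat) :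
  ([set w : edge G -> bool | spanning_tree M [set e | w e]] #= `I_n0)%card ->
  ([set w : edge G -> bool | spanning_tree M [set e | w e] /\
      forall e, e \in F -> w e = false] #= `I_n1)%card ->
  (\int[UST R M]_w (avoid_fun F w)%:E)%E = (n1%:R / n0%:R)%:E.
Proof. by move=> S0 S1; rewrite integral_avoid_fun; exact: uniform_measure_card. Qed.

End Cylinders.

(** * Limits of currents *)

Lemma ultra_fmap (T T' : Type) (f : T -> T') (U : set_system T) :
  UltraFilter U -> UltraFilter (f @ U).
Proof.
move=> UU; split=> [|F FF UF]; first exact: fmap_proper_filter.
apply/seteqP; split=> // A FA.
have [//|Un] := in_ultra_setVsetC (f @^-1` A) UU.
have : F (A `&` ~` A) by apply: filterI => //; exact: UF.
by rewrite setICr => /filter_ex[].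
Qed.

Lemma ultra_bounded_cvg (R : realType) (T : Type) (U : set_system T) (a : T -> R) (B : R) :
  UltraFilter U -> U [set n | `|a n| <= B] -> exists l : R, a @ U --> l.
Proof.
move=> UU aB; have := @segment_compact R (- B) B; rewrite compact_ultra.
move=> /(_ (a @ U) (ultra_fmap a UU)) [|l [_ al]]; last by exists l.
have sub : [set n | `|a n| <= B] `<=` a @^-1` [set` `[- B, B]].
  by move=> n /= aBn; rewrite in_itv /= -ler_norml.
exact: filterS sub aB.
Qed.

Section CvgBig.
Variables (R : realType) (T : Type) (U : set_system T).
Hypothesis UF : Filter U.

Lemma cvg_sum_seq (I : Type) (s : seq I) (P : pred I) (a : I -> T -> R) (l : I -> R) :
  (forall i, a i @ U --> l i) ->
  (fun n => \sum_(i <- s | P i) a i n) @ U --> \sum_(i <- s | P i) l i.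
Proof.
move=> al; elim: s => [|i s IH].
  by under eq_fun do rewrite big_nil; rewrite big_nil; exact: cvg_cst.
under eq_fun do rewrite big_cons; rewrite big_cons; case: (P i) => //.
by apply: cvgD.
Qed.

Lemma cvg_prod_seq (I : Type) (s : seq I) (P : pred I) (a : I -> T -> R) (l : I -> R) :
  (forall i, a i @ U --> l i) ->
  (fun n => \prod_(i <- s | P i) a i n) @ U --> \prod_(i <- s | P i) l i.
Proof.
move=> al; elim: s => [|i s IH].
  by under eq_fun do rewrite big_nil; rewrite big_nil; exact: cvg_cst.
under eq_fun do rewrite big_cons; rewrite big_cons; case: (P i) => //.
by apply: cvgM.
Qed.

Lemma cvg_det k (M : T -> 'M[R]_k) (L : 'M[R]_k) :
  (forall i j, (fun n => M n i j) @ U --> L i j) -> (fun n => \det (M n)) @ U --> \det L.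
Proof.
move=> ML; rewrite /determinant; apply: cvg_sum_seq => s.
by apply: cvgM; [exact: cvg_cst|apply: cvg_prod_seq => i; exact: ML].
Qed.

End CvgBig.

Section CurrentLimits.
Variables (R : realType) (G : sgraph) (es et : edge G -> G).
Hypothesis edge_ends : forall e, val e = [fset es e; et e]%fset.
Hypothesis finite_nbrs : forall x : G, finite_set [set y | adj x y].
Hypothesis G_conn : gconnected G.

Definition nbrs (x : G) := fset_set [set y | adj x y].

Hypothesis liouville : forall k : G -> R,
  (exists B, forall S : seq (edge G), uniq S ->
     \sum_(e <- S) (k (et e) - k (es e)) ^+ 2 <= B) ->
  (forall x, \sum_(y <- nbrs x) (k x - k y) = 0) ->
  forall x y, adj x y -> k x = k y.

Lemma fset2_eq (T : choiceType) (a b c d : T) : [fset a; b]%fset = [fset c; d]%fset ->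
  (a = c /\ b = d) \/ (a = d /\ b = c).
Proof.
move=> /fsetP abcd; have := (abcd a, abcd b, abcd c, abcd d); rewrite !inE !eqxx !orbT /=.
case=> -[[/esym/orP[]/eqP ac /esym/orP[]/eqP bd] /orP[]/eqP ca] /orP[]/eqP db; subst; tauto.
Qed.

Lemma edge_adj (e : edge G) x y : val e = [fset x; y]%fset -> adj x y.
Proof.
have /asboolP[a [b [ab ->]]] := valP e.
by move=> /fset2_eq[[<- <-]//|[<- <-]]; rewrite adj_sym.
Qed.

Lemma ends_adj e : adj (es e) (et e).
Proof. exact: edge_adj (edge_ends e). Qed.

Lemma edge_of_adj x y : adj x y -> exists e : edge G, val e = [fset x; y]%fset.
Proof.
move=> xy; have P : `[< exists a b, adj a b /\ [fset x; y]%fset = [fset a; b]%fset >].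
  by apply/asboolP; exists x, y.
by exists (exist _ [fset x; y]%fset P).
Qed.

(* The potential of the unit current from one end of [e0] to the other in a
   sequence of finite graphs exhausting [G]. *)
Definition current_potential (e0 : edge G) (u : nat -> G -> R) :=
  (forall S : seq (edge G), uniq S ->
     \forall n \near \oo, \sum_(g <- S) (u n (et g) - u n (es g)) ^+ 2 <= 1) /\
  (forall x, \forall n \near \oo,
     \sum_(y <- nbrs x) (u n x - u n y) = (et e0 == x)%:R - (es e0 == x)%:R).

Variable U : set_system nat.
Hypothesis UU : UltraFilter U.
Hypothesis ooU : \oo `<=` U.

(** Potentials matter only up to a constant, hence the base point. Energy at most 1 bounds each
    voltage drop by 1, so the difference to [o] is eventually bounded by the length of a path. *)
Lemma potential_limit e0 u o : current_potential e0 u ->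
  exists h : G -> R, forall x, (fun n => u n x - u n o) @ U --> h x.
Proof.
move=> [uE _].
suff /choice[h hP] : forall x, exists l : R, (fun n => u n x - u n o) @ U --> l by exists h.
move=> x.
have [p [op <-]] := G_conn o x.
apply: (@ultra_bounded_cvg _ _ _ _ (size p)%:R); apply: ooU.
elim: p o op {x} => [|y p IH] o /= op.
  by near=> n; rewrite /= subrr normr0.
case/andP: op => oy /IH{}IH; have [g gE] := edge_of_adj oy.
have gE1 : \forall n \near \oo, `|u n y - u n o| <= 1.
  apply: filterS (uE [:: g] isT) => n; rewrite big_seq1.
  rewrite -real_normK ?num_real // expr_le1 //.
  by have := edge_ends g; rewrite gE => /fset2_eq[[-> ->]//|[-> ->]]; rewrite distrC.
apply: filterS (filterI gE1 IH) => n [h1 h2].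
rewrite /= -(subrKA (u n y)); apply: le_trans (ler_normD _ _) _.
by rewrite -natr1; apply: lerD.
Unshelve. all: by end_near. Qed.

Lemma current_unique e0 u u' : current_potential e0 u -> current_potential e0 u' ->
  forall g, exists l : R,
    (fun n => u n (et g) - u n (es g)) @ U --> l /\
    (fun n => u' n (et g) - u' n (es g)) @ U --> l.
Proof.
move=> uP u'P g; pose o := es g.
have [h hP] := potential_limit o uP; have [h' h'P] := potential_limit o u'P.
have lim_diff v k x y : (forall x, (fun n => v n x - v n o) @ U --> (k x : R)) ->
    (fun n => v n x - v n y : R) @ U --> k x - k y.
  move=> kP; have -> : (fun n => v n x - v n y) =
      (fun n => (v n x - v n o) - (v n y - v n o)) by apply/funext => n; ring.
  exact: cvgB.
exists (h (et g) - h (es g)); split; first exact: lim_diff.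
have energy v k : current_potential e0 v ->
    (forall x, (fun n => v n x - v n o) @ U --> (k x : R)) ->
    forall S, uniq S -> \sum_(e <- S) (k (et e) - k (es e)) ^+ 2 <= 1.
  move=> [vE _] kP S uS.
  have cv : (fun n => \sum_(e <- S) (v n (et e) - v n (es e)) ^+ 2) @ U -->
      \sum_(e <- S) (k (et e) - k (es e)) ^+ 2.
    by apply: cvg_sum_seq => e; apply: cvgM; exact: lim_diff.
  rewrite -(cvg_lim _ cv) //; apply: limr_le; first exact: cvgP cv.
  by apply: ooU; exact: vE.
have node v k : current_potential e0 v ->
    (forall x, (fun n => v n x - v n o) @ U --> (k x : R)) ->
    forall x, \sum_(y <- nbrs x) (k x - k y) = (et e0 == x)%:R - (es e0 == x)%:R.
  move=> [_ vN] kP x.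
  have cv : (fun n => \sum_(y <- nbrs x) (v n x - v n y)) @ U --> \sum_(y <- nbrs x) (k x - k y).
    by apply: cvg_sum_seq => y; exact: lim_diff.
  rewrite -(cvg_lim _ cv) //; apply/cvg_lim => //; apply: cvg_near_cst.
  by apply: ooU; exact: vN.
suff -> : h (et g) - h (es g) = h' (et g) - h' (es g) by exact: lim_diff.
have kP : h (es g) - h' (es g) = h (et g) - h' (et g).
  apply: (liouville (k := fun x => h x - h' x)); last exact: ends_adj.
    (* Each limit has energy at most 1, and the square of a difference is at most twice the sum of
       the squares, which gives 4. *)
    exists 4 => S uS; apply: (@le_trans _ _ (\sum_(e <- S)
      (2 * (h (et e) - h (es e)) ^+ 2 + 2 * (h' (et e) - h' (es e)) ^+ 2))).
      apply: ler_sum => e _; set a := h (et e); set b := h (es e).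
      set c := h' (et e); set d := h' (es e); have := sqr_ge0 ((a - b) + (c - d)); nra.
    rewrite big_split /= -!mulr_sumr.
    have := energy u h uP hP S uS; have := energy u' h' u'P h'P S uS; lra.
  move=> x; rewrite -[RHS](subrr ((et e0 == x)%:R - (es e0 == x)%:R)).
  rewrite -[X in _ = X - _](node u h uP hP) -[X in _ = _ - X](node u' h' u'P h'P).
  by rewrite -sumrB; apply: eq_bigr => y _; ring.
lra.
Qed.

End CurrentLimits.

Lemma near_all_seq (T : eqType) (s : seq T) (P : nat -> T -> Prop) :
  (forall a, a \in s -> \forall n \near \oo, P n a) ->
  \forall n \near \oo, forall a, a \in s -> P n a.
Proof.
elim: s => [|b s IH] sP; first by near=> n.
have h1 : \forall n \near \oo, P n b by apply: sP; rewrite inE eqxx.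
have h2 : \forall n \near \oo, forall a, a \in s -> P n a.
  by apply: IH => a aS; apply: sP; rewrite inE aS orbT.
apply: filterS (filterI h1 h2) => n [nb ns] a; rewrite inE => /orP[/eqP ->//|]; exact: ns.
Unshelve. all: by end_near. Qed.

Lemma near_all_finite (T : choiceType) (A : set T) (P : nat -> T -> Prop) :
  finite_set A -> (forall a, A a -> \forall n \near \oo, P n a) ->
  \forall n \near \oo, forall a, A a -> P n a.
Proof.
move=> Afin AP; have := @near_all_seq _ (fset_set A) P.
have mA a : (a \in (fset_set A : seq T)) <-> A a.
  by rewrite -[a \in _]/(a \in fset_set A) in_fset_set // inE.
move=> /(_ (fun a aA => AP a ((mA a).1 aA))); apply: filterS => n h a /mA; exact: h.
Qed.

Lemma ler_sum_sub (R : realDomainType) (T : eqType) (s s' : seq T) (f : T -> R) :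
  uniq s -> uniq s' -> {subset s <= s'} -> (forall a, 0 <= f a) ->
  \sum_(a <- s) f a <= \sum_(a <- s') f a.
Proof.
move=> us us' ss f0; rewrite [X in _ <= X](bigID (mem s)) /=.
have -> : \sum_(a <- s' | a \in s) f a = \sum_(a <- s) f a.
  rewrite -big_filter; apply: perm_big; apply: uniq_perm; rewrite ?filter_uniq // => a.
  by rewrite mem_filter /= andb_idr //; exact: ss.
by rewrite lerDl sumr_ge0.
Qed.

Section Forests.
Variables (R : realType) (G : sgraph) (es et : edge G -> G).
Hypothesis edge_ends : forall e, val e = [fset es e; et e]%fset.
Hypothesis finite_nbrs : forall x : G, finite_set [set y | adj x y].

Lemma ends_neq e : es e != et e.
Proof. by apply/eqP => ee; have := ends_adj edge_ends e; rewrite ee adj_irr. Qed.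

Lemma mem_ends (e : edge G) x : (x \in val e) = (es e == x) || (et e == x).
Proof. by rewrite edge_ends !inE ![x == _]eq_sym. Qed.

Lemma finite_incident (x : G) : finite_set [set e : edge G | x \in val e].
Proof.
apply: (@sub_finite_set _ _ (val @^-1` ((fun y => [fset x; y]%fset) @` [set y : G | adj x y]))).
  move=> e /=; have ea := ends_adj edge_ends e.
  rewrite mem_ends => /orP[]/eqP ex; rewrite -ex.
    by exists (et e) => //; exact/esym/edge_ends.
  exists (es e); first by rewrite /= adj_sym.
  by rewrite [RHS](edge_ends e) fsetUC.
apply: finite_preimage; last exact: finite_image.
by move=> ? ? _ _; exact: val_inj.
Qed.

(** In a simple graph the edges at [x] correspond to its neighbours, and each contributes [f x]
    minus the value at its other end, whatever its orientation. *)
Lemma node_sum (ES : seq (edge G)) (x : G) (f : G -> R) : uniq ES ->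
  (forall e : edge G, x \in val e -> e \in ES) ->
  \sum_(e <- ES) ((et e == x)%:R - (es e == x)%:R) * (f (et e) - f (es e)) =
  \sum_(y <- nbrs x) (f x - f y).
Proof.
move=> uES xES; pose other e := if es e == x then et e else es e.
rewrite (bigID (fun e : edge G => x \in val e)) /= [X in _ + X]big1 ?addr0; last first.
  move=> e; rewrite mem_ends negb_or => /andP[/negbTE -> /negbTE ->].
  by rewrite subrr mul0r.
transitivity (\sum_(e <- ES | x \in val (e : edge G)) (f x - f (other e))).
  apply: eq_bigr => e; rewrite mem_ends /other; have := ends_neq e.
  have [->|ne] := eqVneq (es e) x; first by rewrite eq_sym => /negbTE -> _ /=; ring.
  by move=> _ /= /eqP ->; rewrite eqxx /=; ring.
transitivity (\sum_(y <- [seq other e | e : edge G <- ES & x \in val e]) (f x - f y)).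
  by rewrite big_map big_filter.
apply: perm_big.
apply: uniq_perm; rewrite ?fset_uniq //.
  rewrite map_inj_in_uniq ?filter_uniq // => e e'; rewrite !mem_filter.
  have valE (d : edge G) : x \in val d -> val d = [fset x; other d]%fset.
    rewrite mem_ends /other edge_ends; have [->//|_] := eqVneq (es d) x.
    by move=> /= /eqP ->; rewrite fsetUC.
  by move=> /andP[/valE ev _] /andP[/valE ev' _] oo; apply: val_inj; rewrite /= ev ev' oo.
move=> y; rewrite [RHS](in_fset_set (finite_nbrs x)); apply/mapP/idP => [[e]|].
  rewrite mem_filter mem_ends /other inE /= => /andP[xe _] ->.
  have := ends_adj edge_ends e; move: xe.
  by have [->|_ /= /eqP ->] := eqVneq (es e) x; rewrite // adj_sym.
rewrite inE /= => xy; have [e eE] := edge_of_adj xy.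
have xe : x \in val e by rewrite eE !inE eqxx.
exists e; first by rewrite mem_filter xe xES.
have := edge_ends e; rewrite eE /other => /fset2_eq[[-> ->]|[-> ->]]; first by rewrite eqxx.
case: eqVneq => // yx; by rewrite yx adj_irr in xy.
Qed.

(** The common outcome of free and wired exhaustions. It no longer mentions the finite graphs, which
    makes the two measures comparable. *)
Definition limit_potentials (mu : probability (borel (config G)) R) :=
  exists phi : nat -> edge G -> G -> R,
  (forall e, current_potential es et e (fun n => phi n e)) /\
  forall k (f : 'I_k -> edge G) (F : {fset edge G}), injective f ->
    (forall e, e \in F <-> exists a, e = f a) ->
    (fun n => \det (1%:M - \matrix_(a, b)
      (phi n (f b) (et (f a)) - phi n (f b) (es (f a))))) @ \oo --> fine (mu (avoid F)).

(** * Passage to the limit along finite multigraphs, with [pi n] sending vertices of [G] to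
    theirs *)

Section Approximation.
Variables (W : choiceType) (M : nat -> mgraph W (edge G)) (pi : nat -> G -> W).
Variable mu : probability (borel (config G)) R.
Hypothesis fin_verts : forall n, finite_set (mverts (M n)).
Hypothesis verts_neq0 : forall n, mverts (M n) !=set0.
Hypothesis fin_edges : forall n, finite_set (medges (M n)).
Hypothesis endsE : forall n e a b, medges (M n) e ->
  (mends (M n) e a b <->
    (a = pi n (es e) /\ b = pi n (et e)) \/ (a = pi n (et e) /\ b = pi n (es e))).
Hypothesis ends_verts : forall n e, medges (M n) e ->
  [/\ mverts (M n) (pi n (es e)), mverts (M n) (pi n (et e)) & pi n (es e) <> pi n (et e)].
Hypothesis edges_near : forall e, \forall n \near \oo, medges (M n) e.
Hypothesis verts_near : forall x, \forall n \near \oo,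
  mverts (M n) (pi n x) /\ forall y, pi n y = pi n x -> y = x.
Hypothesis cvg_mu : weak_cvg (fun n => UST R (M n)) mu.

Lemma cvg_avoid F : (fun n => fine (\int[UST R (M n)]_w (avoid_fun R F w)%:E)%E) @ \oo -->
  fine (mu (avoid F)).
Proof.
have := cvg_mu (@avoid_fun_continuous G R F) (@avoid_fun_bounded G R F).
rewrite integral_avoid_fun => cv; apply: fine_cvg; rewrite fineK //.
exact: (fin_num_measure mu _ (avoid_measurable R F)).
Qed.

Lemma approximating_potentials : limit_potentials mu.
Proof.
have /choice[n0 n0P] : forall n, exists n0 : nat,
    ([set w : edge G -> bool | spanning_tree (M n) [set e | w e]] #= `I_n0)%card /\
    ((n0 != 0)%N ->
      exists phi : edge G -> W -> R, transfer_potential (M n) (pi n \o es) (pi n \o et) n0 phi).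
  move=> n; have [n0 n0c n0P] := @finite_transfer_current R W (edge G) (M n)
    (pi n \o es) (pi n \o et) (fin_verts n) (verts_neq0 n) (fin_edges n)
    (@endsE n) (@ends_verts n).
  by exists n0.
have /choice[psi psiP] : forall n, exists phi : edge G -> W -> R, (n0 n != 0)%N ->
    transfer_potential (M n) (pi n \o es) (pi n \o et) (n0 n) phi.
  move=> n; have [n00|nn0] := boolP (n0 n == 0)%N; first by exists (fun _ _ => 0).
  by have [_ /(_ nn0)[phi phiP]] := n0P n; exists phi.
(* The total mass of [UST] is [n0 / n0], which is 0 when there is no spanning tree. *)
have n0_near : \forall n \near \oo, (n0 n != 0)%N.
  have := @cvg_avoid fset0; rewrite avoid0 probability_setT /= => /cvgr_gt /(_ 2^-1).
  have half : 2^-1 < 1 :> R by lra.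
  move=> /(_ half); apply: filterS => n; apply: contraTneq => n00.
  rewrite (@integral_UST_avoid G R _ (M n) fset0 (n0 n) (n0 n)).
  - by rewrite n00 /= mul0r; lra.
  - exact: (n0P n).1.
  - have -> : [set w : edge G -> bool | spanning_tree (M n) [set e | w e] /\
        forall e, e \in fset0 -> w e = false] =
      [set w : edge G -> bool | spanning_tree (M n) [set e | w e]].
      by apply/seteqP; split=> w /=; [case|].
    exact: (n0P n).1.
exists (fun n e x => psi n e (pi n x)); split=> [e|k f F f_inj FE].
- split=> [S uS|x].
    have Snear : \forall n \near \oo, forall g, g \in S -> medges (M n) g.
      by apply: near_all_seq => g _; exact: edges_near.
    apply: filterS (filterI (filterI n0_near (edges_near e)) Snear) => n [[nn0 eM] SM].
    have [_ energy _] := psiP n nn0.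
    apply: le_trans (energy e eM); apply: ler_sum_sub => //.
    + by move=> g /SM gM; rewrite -[_ \in _]/(g \in fset_set _) in_fset_set // inE.
    + by move=> g; exact: sqr_ge0.
  (* Only finitely many edges meet [x], so eventually all are present; with [pi n] separating [x]
     from the other vertices, the node law of [M n] at [pi n x] becomes that of [G] at [x]. *)
  have xnear : \forall n \near \oo, forall g : edge G, x \in val g -> medges (M n) g.
    apply: (near_all_finite (A := [set g : edge G | x \in val g])); first exact: finite_incident.
    by move=> g _; exact: edges_near.
  apply: filterS (filterI (filterI n0_near (edges_near e)) (filterI xnear (verts_near x))).
  move=> n [[nn0 eM] [xM [xV pi_inj]]]; have [node _ _] := psiP n nn0.
  have piE y : (pi n y == pi n x) = (y == x) by apply/eqP/eqP => [/pi_inj|->].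
  have := node e (pi n x) eM xV; rewrite !piE => <-.
  under [RHS]eq_bigr do rewrite !piE.
  rewrite (@node_sum (fset_set (medges (M n))) x (fun y => psi n e (pi n y))) //.
  by move=> g /xM gM; rewrite -[_ \in _]/(g \in fset_set _) in_fset_set // inE.
- apply: cvg_trans (@cvg_avoid F); apply: near_eq_cvg.
  have fnear : \forall n \near \oo, forall a, medges (M n) (f a).
    have : \forall n \near \oo, forall e, e \in (F : seq _) -> medges (M n) e.
      by apply: near_all_seq => g _; exact: edges_near.
    by apply: filterS => n h a; apply: h; apply/FE; exists a.
  apply: filterS (filterI n0_near fnear) => n [nn0 fM].
  have [_ _ /(_ k f f_inj fM)[n1 n1c n1E]] := psiP n nn0.
  rewrite (@integral_UST_avoid G R _ (M n) F (n0 n) n1) //=.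
  + by rewrite n1E mulrC mulKf // pnatr_eq0.
  + exact: (n0P n).1.
  + have -> : [set w : edge G -> bool | spanning_tree (M n) [set e | w e] /\
        forall e, e \in F -> w e = false] =
      [set w : edge G -> bool | spanning_tree (M n) [set e | w e] /\
        forall a, w (f a) = false].
      apply/seteqP; split=> w /= [wT wF]; split=> //.
        by move=> a; apply: wF; apply/FE; exists a.
      by move=> e /FE[a ->].
    exact: n1c.
Qed.

End Approximation.
End Forests.

Lemma edge_orientation (G : sgraph) :
  exists es et : edge G -> G, forall e, val e = [fset es e; et e]%fset.
Proof.
have /choice[f fP] : forall e : edge G, exists xy : G * G, val e = [fset xy.1; xy.2]%fset.
  by move=> e; have /asboolP[x [y [_ ->]]] := valP e; exists (x, y).
by exists (fun e => (f e).1), (fun e => (f e).2).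
Qed.

(** * Free and wired exhaustions *)

Section Exhaustions.
Variables (G : sgraph) (K_ : nat -> {fset G}).
Hypothesis K_exh : exhaustion K_.

Lemma exhaustion_le m n : (m <= n)%N -> (K_ m `<=` K_ n)%fset.
Proof.
have [_ Kmono _] := K_exh; move=> /subnKC <-; elim: (n - m)%N => [|k IH].
  by rewrite addn0.
by rewrite addnS; apply: fsubset_trans IH (Kmono _).
Qed.

Lemma exhaustion_near x : \forall n \near \oo, x \in K_ n.
Proof.
have [_ _ /(_ x)[m xm]] := K_exh; exists m => // n /= mn.
exact: (fsubsetP (exhaustion_le mn)).
Qed.

Lemma exhaustion_edge_near (e : edge G) : \forall n \near \oo, (val e `<=` K_ n)%fset.
Proof.
have /asboolP[x [y [_ ->]]] := valP e.
apply: filterS (filterI (exhaustion_near x) (exhaustion_near y)) => n [xn yn].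
by apply/fsubsetP => z; rewrite !inE => /orP[]/eqP ->.
Qed.

(** Two vertices lie in a common connected [K_ n]. This supplies connectedness of the Diestel-Leader
    graph without constructing paths in it. *)
Lemma exhaustion_connected : gconnected G.
Proof.
move=> x y; have [Kc _ _] := K_exh.
have [n [xn yn]] : exists n, x \in K_ n /\ y \in K_ n.
  exact: (filter_ex (filterI (exhaustion_near x) (exhaustion_near y))).
have [_ /(_ x y xn yn)[p [xp py]]] := Kc n.
exists (unzip2 p); split=> //; elim: p x xp {py xn} => [|[e z] p IH] x //= [_ xz /IH ->].
by rewrite andbT; exact: edge_adj xz.
Qed.

End Exhaustions.

Lemma finite_sub_edges (G : sgraph) (K : {fset G}) :
  finite_set [set e : edge G | (val e `<=` K)%fset].
Proof.
have -> : [set e : edge G | (val e `<=` K)%fset] = val @^-1` [set` fpowerset K].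
  by apply/seteqP; split=> e /=; rewrite fpowersetE.
by apply: finite_preimage => // ? ? _ _; exact: val_inj.
Qed.

Section FreeWired.
Variables (R : realType) (G : sgraph) (es et : edge G -> G).
Hypothesis edge_ends : forall e, val e = [fset es e; et e]%fset.
Hypothesis finite_nbrs : forall x : G, finite_set [set y | adj x y].

Lemma FUSF_potentials (mu : probability (borel (config G)) R) (K_ : nat -> {fset G}) :
  exhaustion K_ -> weak_cvg (fun n => UST R (induced_mgraph (K_ n))) mu ->
  limit_potentials es et mu.
Proof.
move=> Kexh; have [Kc _ _] := Kexh.
apply: (@approximating_potentials R G es et edge_ends finite_nbrs G
  (fun n => induced_mgraph (K_ n)) (fun _ x => x)) => /=.
- by move=> n; exact: finite_fset.
- by move=> n; have [/fset0Pn[x xK] _] := Kc n; exists x.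
- by move=> n; exact: finite_sub_edges.
- move=> n e a b _; rewrite (edge_ends e); split; last by case=> -[-> ->] //; rewrite fsetUC.
  by move=> /fset2_eq[[-> ->]|[-> ->]]; [left|right].
- move=> n e /fsubsetP eK; split; last exact/eqP/(ends_neq edge_ends).
    by apply: eK; rewrite (mem_ends edge_ends) eqxx.
  by apply: eK; rewrite (mem_ends edge_ends) eqxx orbT.
- by move=> e; exact: exhaustion_edge_near.
- by move=> x; apply: filterS (exhaustion_near Kexh x) => n xn; split.
Qed.

Lemma WUSF_potentials (mu : probability (borel (config G)) R) (K_ : nat -> {fset G}) :
  exhaustion K_ -> weak_cvg (fun n => UST R (wired_mgraph (K_ n))) mu ->
  limit_potentials es et mu.
Proof.
move=> Kexh; have [Kc _ _] := Kexh.
have loop n e : medges (wired_mgraph (K_ n)) e -> wire (K_ n) (es e) <> wire (K_ n) (et e).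
  move=> /= eM ee; apply: eM; exists (wire (K_ n) (es e)), (es e), (et e).
  by split=> //; exact: edge_ends.
(* An edge with both ends outside is a loop at [None] and was deleted; hence local finiteness leaves
   finitely many edges. *)
have touch n e : medges (wired_mgraph (K_ n)) e -> es e \in K_ n \/ et e \in K_ n.
  move=> /loop; rewrite /wire; case: ifP => [|_]; first by left.
  by case: ifP => //; right.
apply: (@approximating_potentials R G es et edge_ends finite_nbrs (option G)
  (fun n => wired_mgraph (K_ n)) (fun n => wire (K_ n))).
- move=> n; apply: (@sub_finite_set _ _ (None |` (Some @` [set` K_ n]))).
    by move=> _ [x _ <-]; rewrite /wire; case: ifP => xK; [right; exists x|left].
  by rewrite finite_setU; split; [exact: finite_set1|apply: finite_image; exact: finite_fset].
- by move=> n; have [/fset0Pn[x xK] _] := Kc n; exists (wire (K_ n) x), x.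
- move=> n; apply: (@sub_finite_set _ _ (\bigcup_(x in [set` K_ n]) [set e : edge G | x \in val e])).
    move=> e /touch[eK|eK]; [exists (es e)|exists (et e)] => //=;
      by rewrite (mem_ends edge_ends) eqxx ?orbT.
  apply: bigcup_finite; first exact: finite_fset.
  by move=> x _; exact: (finite_incident edge_ends finite_nbrs).
- move=> n e a b _ /=; split.
    move=> [x [y [+ -> ->]]]; rewrite (edge_ends e).
    by move=> /fset2_eq[[-> ->]|[-> ->]]; [left|right].
  case=> -[-> ->]; first by exists (es e), (et e); split=> //; exact: edge_ends.
  by exists (et e), (es e); rewrite fsetUC; split=> //; exact: edge_ends.
- by move=> n e /loop ee; split=> //=; [exists (es e)|exists (et e)].
- move=> e; apply: filterS (exhaustion_edge_near Kexh e) => n /fsubsetP eK /= [a [x [y [eE ->]]]].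
  have xy := edge_adj (eE : val e = _).
  have [xK yK] : x \in K_ n /\ y \in K_ n by split; apply: eK; rewrite (eE : val e = _) !inE eqxx ?orbT.
  by rewrite /wire xK yK => -[xyE]; rewrite xyE adj_irr in xy.
- move=> x; apply: filterS (exhaustion_near Kexh x) => n xn; split; first by exists x.
  by move=> y; rewrite /wire xn; case: ifP => // _ [].
Qed.

Hypothesis liouville : forall k : G -> R,
  (exists B, forall S : seq (edge G), uniq S ->
     \sum_(e <- S) (k (et e) - k (es e)) ^+ 2 <= B) ->
  (forall x, \sum_(y <- nbrs x) (k x - k y) = 0) ->
  forall x y, adj x y -> k x = k y.

Theorem free_eq_wired (mu nu : probability (borel (config G)) R) :
  is_FUSF mu -> is_WUSF nu -> forall A, measurable A -> mu A = nu A.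
Proof.
move=> [K Kexh muK] [K' K'exh nuK'].
have [phi [phi_pot phi_det]] := FUSF_potentials Kexh muK.
have [psi [psi_pot psi_det]] := WUSF_potentials K'exh nuK'.
(* One ultrafilter serves all pairs of edges and both exhaustions, even when these differ. *)
have [U [UU ooU]] := ultraFilterLemma (_ : ProperFilter \oo).
have lims e g := current_unique edge_ends (exhaustion_connected Kexh) liouville UU ooU
  (phi_pot e) (psi_pot e) g.
have /choice[Y YP] : forall eg : edge G * edge G, exists l : R,
    (fun n => phi n eg.1 (et eg.2) - phi n eg.1 (es eg.2)) @ U --> l /\
    (fun n => psi n eg.1 (et eg.2) - psi n eg.1 (es eg.2)) @ U --> l.
  by move=> [e g]; exact: lims.
apply: (@avoid_determines _ _ (fun n => fset_set [set e : edge G | (val e `<=` K n)%fset])).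
- move=> n; rewrite -fset_set_sub; [|exact: finite_sub_edges|exact: finite_sub_edges].
  by move=> e /= eK; apply: fsubset_trans eK _; apply: (exhaustion_le Kexh).
- move=> e; have /filter_ex[n en] := exhaustion_edge_near Kexh e.
  by exists n; rewrite in_fset_set ?inE //; exact: finite_sub_edges.
move=> F; have [k [f [f_inj fE _]]] := finite_set_enum (finite_fset F).
have det_lim (th : nat -> edge G -> G -> R) :
    (forall e g, (fun n => th n e (et g) - th n e (es g)) @ U --> Y (e, g)) ->
    (fun n => \det (1%:M - \matrix_(a, b)
      (th n (f b) (et (f a)) - th n (f b) (es (f a))))) @ U -->
    \det (1%:M - \matrix_(a, b) Y (f b, f a)).
  move=> thP; apply: cvg_det => i j; rewrite !mxE.
  under eq_fun do rewrite !mxE.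
  by apply: cvgB; [exact: cvg_cst|exact: thP].
have fin (la : probability (borel (config G)) R) : la (avoid F) \is a fin_num.
  exact: (fin_num_measure la _ (avoid_measurable R F)).
rewrite -[mu _]fineK // -[nu _]fineK //; congr (_%:E).
have PU : ProperFilter U by exact: ultra_proper.
have oU (a : nat -> R) (l : R) : a @ \oo --> l -> a @ U --> l.
  by move=> al; apply: cvg_trans al; exact: cvg_app.
have e1 := oU _ _ (phi_det k f F f_inj fE).
have e2 := oU _ _ (psi_det k f F f_inj fE).
have l1 := det_lim phi (fun e g => (YP (e, g)).1).
have l2 := det_lim psi (fun e g => (YP (e, g)).2).
rewrite -(cvg_lim _ e1) // -(cvg_lim _ e2) //.
by rewrite (cvg_lim _ l1) // (cvg_lim _ l2).
Qed.

End FreeWired.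

(** * Diestel-Leader graphs *)

Lemma lvl_shift (U V : htree) (c : U) (z : V) :
  lvl c + lvl (par z) = lvl (par c) + lvl z.
Proof. by rewrite !lvl_par addrA addrAC. Qed.

Lemma lvl_par2 (U V : htree) (x : U) (z : V) :
  lvl (par x) + lvl (par z) = lvl x + lvl z + 2.
Proof. by rewrite !lvl_par; lia. Qed.

Lemma par2_neq (U : htree) (x : U) : par (par x) <> x.
Proof. by move=> e; have := lvl_par (par x); rewrite e lvl_par; lia. Qed.

Section DLLiouville.
Variables (R : realType) (q r : nat) (T1 T2 : sgraph).
Hypotheses (q_ge2 : (2 <= q)%N) (r_ge2 : (2 <= r)%N).
Hypotheses (T1_tree : is_tree T1) (T1_reg : regular q.+1 T1).
Hypotheses (T2_tree : is_tree T2) (T2_reg : regular r.+1 T2).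
Variables (o1 : T1) (o2 : T2) (w1 : set (nat -> T1)) (w2 : set (nat -> T2)).
Hypotheses (w1_end : is_end w1) (w2_end : is_end w2).

Local Notation D := (DL o1 o2 w1 w2).
Let U : htree := end_htree o1 T1_tree w1_end q_ge2 T1_reg.
Let V : htree := end_htree o2 T2_tree w2_end r_ge2 T2_reg.

Let in_DL (p : U * V) := lvl p.1 + lvl p.2 == 0.

Let DL_point (p : U * V) (Hp : in_DL p) : D :=
  exist (fun x : T1 * T2 => busemann o1 w1 x.1 + busemann o2 w2 x.2 == 0) p Hp.

Let DL_neighbours (u : D) : seq (U * V) :=
  [seq (c, par ((val u).2 : V)) | c <- ch ((val u).1 : U)] ++
  [seq (par ((val u).1 : U), c) | c <- ch ((val u).2 : V)].

Lemma adjU (x y : U) : @adj T1 x y <-> par x = y \/ par y = x.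
Proof. exact: adj_parP. Qed.

Lemma adjV (x y : V) : @adj T2 x y <-> par x = y \/ par y = x.
Proof. exact: adj_parP. Qed.

Lemma DL_neighboursP (u : D) (p : U * V) :
  p \in DL_neighbours u <-> exists2 y : D, adj u y & val y = p.
Proof.
case: u => [[x z] /= xz]; have xz0 : lvl (x : U) + lvl (z : V) = 0 by apply/eqP.
rewrite mem_cat; split.
- move=> /orP[]/mapP[c]; rewrite mem_ch => /eqP cE ->.
    have H : in_DL (c, par (z : V)).
      by apply/eqP; apply: etrans (lvl_shift c (z : V)) _; rewrite cE; exact: xz0.
    exists (DL_point H) => //=; apply/andP; split => /=.
      by apply/adjU; right.
    by apply/adjV; left.
  have H : in_DL (par (x : U), c).
    by apply/eqP; apply: etrans (esym (lvl_shift (x : U) c)) _; rewrite cE; exact: xz0.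
  exists (DL_point H) => //=; apply/andP; split => /=.
    by apply/adjU; left.
  by apply/adjV; right.
- move=> [[[y1 y2] yH] a12 <-]; have [/adjU a1 /adjV a2] : adj x y1 /\ adj z y2 by apply/andP.
  (* Of the four combinations of moves, the two going the same way in both trees would change the
     total level by 2 and are excluded. *)
  have y0 : lvl (y1 : U) + lvl (y2 : V) = 0 by apply/eqP.
  case: a1 => e1; case: a2 => e2.
  + by have := @lvl_par2 U V x z; rewrite e1 e2 y0 xz0.
  + apply/orP; right; apply/mapP; exists y2; last by congr (_, _); exact: esym e1.
    by rewrite mem_ch; apply/eqP.
  + apply/orP; left; apply/mapP; exists y1; last by congr (_, _); exact: esym e2.
    by rewrite mem_ch; apply/eqP.
  + by have := @lvl_par2 U V y1 y2; rewrite e1 e2 y0 xz0.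
Qed.

Lemma DL_finite_nbrs (u : D) : finite_set [set y | adj u y].
Proof.
apply: (@sub_finite_set _ _ (val @^-1` [set` DL_neighbours u])).
  by move=> y uy /=; apply/DL_neighboursP; exists y.
by apply: finite_preimage; [move=> ? ? _ _; exact: val_inj|exact: finite_seq].
Qed.

Lemma perm_nbrs (u : D) : perm_eq [seq val y | y <- nbrs u] (DL_neighbours u).
Proof.
apply: uniq_perm.
- by rewrite map_inj_uniq ?fset_uniq //; exact: val_inj.
- rewrite cat_uniq; apply/and3P; split.
  + by rewrite map_inj_uniq ?ch_uniq // => ? ? [].
  + apply/hasPn => p /mapP[c _ ->]; apply/negP => /mapP[c' + [e _]].
    by rewrite -e mem_ch => /eqP/par2_neq.
  + by rewrite map_inj_uniq ?ch_uniq // => ? ? [].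
- move=> p; apply/mapP/idP => [[y yu ->]|/DL_neighboursP[y uy yp]].
    apply/DL_neighboursP; exists y => //.
    by have : y \in fset_set [set y | adj u y] := yu; rewrite in_fset_set ?inE //; exact: DL_finite_nbrs.
  exists y => //; rewrite -[_ \in _]/(y \in fset_set [set y | adj u y]).
  by rewrite in_fset_set ?inE //; exact: DL_finite_nbrs.
Qed.

Variables (es et : edge D -> D).
Hypothesis edge_ends : forall e, val e = [fset es e; et e]%fset.

(** Extension by 0 to all pairs. Edges of the product preserve the total level, so neither energy
    nor harmonicity sees the jump at the boundary of level 0. *)
Let ext (k : D -> R) (x : U) (z : V) : R :=
  if insub (x, z) is Some u then k u else 0.

Lemma ext_val k (u : D) : ext k (val u).1 (val u).2 = k u.
Proof. by rewrite /ext -surjective_pairing valK. Qed.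

Lemma ext_out k (x : U) (z : V) : lvl x + lvl z != 0 -> ext k x z = 0.
Proof. by move=> xz; rewrite /ext insubF //; apply/negbTE. Qed.

Lemma grad_out k c z : lvl c + lvl (par z) != 0 -> grad (ext k) c z = 0.
Proof.
by move=> cz; rewrite /grad !ext_out ?subrr // -lvl_shift.
Qed.

Lemma DL_edge (c : U) (z : V) : lvl c + lvl (par z) = 0 ->
  exists u v : D, [/\ adj u v, val u = (par c, z) & val v = (c, par z)].
Proof.
move=> cz; have Hv : in_DL (c, par z) by apply/eqP.
have Hu : in_DL (par c, z) by apply/eqP; apply: etrans cz; exact/esym/lvl_shift.
exists (DL_point Hu), (DL_point Hv); split=> //; apply/andP; split=> /=.
  by apply/adjU; right.
by apply/adjV; left.
Qed.

(** The induction also records which pair each edge comes from, in order to see that the new edge is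
    not already in the list. *)
Lemma ext_energy k (S : seq (U * V)) : uniq S ->
  exists2 ES : seq (edge D), uniq ES &
    \sum_(p <- S) grad (ext k) p.1 p.2 ^+ 2 = \sum_(e <- ES) (k (et e) - k (es e)) ^+ 2.
Proof.
move=> uS; suff [ES [uES sumE _]] : exists ES : seq (edge D), [/\ uniq ES,
    \sum_(p <- S) grad (ext k) p.1 p.2 ^+ 2 = \sum_(e <- ES) (k (et e) - k (es e)) ^+ 2 &
    forall e, e \in ES -> exists p (u v : D), [/\ p \in S, val e = [fset u; v]%fset,
      val u = (par p.1, p.2) & val v = (p.1, par p.2)]] by exists ES.
elim: S uS => [|[c z] S IH] /=; first by exists [::]; rewrite !big_nil.
move=> /andP[czS /IH[ES [uES sumE ESp]]].
have [cz|cz] := eqVneq (lvl c + lvl (par z)) 0; last first.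
  exists ES; split=> //; first by rewrite big_cons /= grad_out // expr0n add0r.
  move=> e /ESp[p [u [v [pS eE uE vE]]]]; exists p, u, v; split=> //.
  by rewrite inE pS orbT.
have [u [v [uv uE vE]]] := DL_edge cz; have [e eE] := edge_of_adj uv.
exists (e :: ES); split.
- rewrite /= uES andbT; apply/negP => /ESp[[c' z'] [u' [v' [pS' e' u'E v'E]]]].
  move: e'; rewrite eE => /fset2_eq[[uu vv]|[uv' vu']].
    move: uE vE; rewrite uu vv u'E v'E /= => -[_ zz] [cc _].
    by rewrite -zz -cc pS' in czS.
  (* The same edge read in the opposite direction would give [par (par c) = c], against the
     levels. *)
  move: uE vE; rewrite uv' vu' u'E v'E /= => -[e1 _] [e2 _].
  exact: (@par2_neq U c (etrans (congr1 (@par U) (esym e1)) e2)).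
- rewrite !big_cons sumE; congr (_ + _).
  have -> : grad (ext k) c z = k v - k u.
    by rewrite /grad -(ext_val k v) -(ext_val k u) uE vE.
  have := edge_ends e; rewrite eE => /fset2_eq[[-> ->]//|[-> ->]].
  by rewrite -sqrrN opprB.
- move=> e'; rewrite inE => /orP[/eqP ->|/ESp[p [u' [v' [pS e'E u'E v'E]]]]].
    by exists (c, z), u, v; split=> //; rewrite inE eqxx.
  by exists p, u', v'; split=> //; rewrite inE pS orbT.
Qed.

Lemma DL_liouville (k : D -> R) :
  (exists B, forall S : seq (edge D), uniq S ->
     \sum_(e <- S) (k (et e) - k (es e)) ^+ 2 <= B) ->
  (forall x, \sum_(y <- nbrs x) (k x - k y) = 0) ->
  forall x y, adj x y -> k x = k y.
Proof.
move=> [B energy] harm.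
have grad0 : forall c z, grad (ext k) c z = 0.
  apply: (@harmonic_dirichlet_trivial R U V (ext k) B).
    by move=> S /(ext_energy k)[ES uES ->]; exact: energy.
  move=> x z; have [xz|xz] := eqVneq (lvl x + lvl z) 0; last first.
    rewrite !big_seq !big1 ?addr0 // => c; rewrite mem_ch => /eqP cE.
      by rewrite (ext_out k xz) (@ext_out k (par x) c) ?subrr // -(@lvl_shift U V x c) cE.
    by rewrite (ext_out k xz) (@ext_out k c (par z)) ?subrr // (@lvl_shift U V c z) cE.
  have Hu : in_DL (x, z) by apply/eqP.
  pose u := DL_point Hu; rewrite -[RHS](harm u).
  transitivity (\sum_(p <- DL_neighbours u) (k u - ext k p.1 p.2)).
    by rewrite big_cat !big_map /= -(ext_val k u).
  rewrite -(perm_big _ (perm_nbrs u)) big_map; apply: eq_bigr => y _.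
  by rewrite ext_val.
have ext_adj (u : D) p : p \in DL_neighbours u -> k u = ext k p.1 p.2.
  rewrite mem_cat -(ext_val k u) => /orP[]/mapP[c]; rewrite mem_ch => /eqP cE -> /=.
    by have /eqP := grad0 c (val u).2; rewrite subr_eq0 cE => /eqP ->.
  by have /eqP := grad0 (val u).1 c; rewrite subr_eq0 cE => /eqP ->.
move=> u y uy; rewrite -(ext_val k y); apply: ext_adj.
by apply/DL_neighboursP; exists y.
Qed.

End DLLiouville.

Unset Implicit Arguments.

Theorem proposition5p3 (R : realType) (q r : nat) (r_ge2 : (2 <= r)%N)
    (le_rq : (r <= q)%N) (T1 T2 : sgraph)
    (T1_tree : is_tree T1) (T1_reg : regular q.+1 T1)
    (T2_tree : is_tree T2) (T2_reg : regular r.+1 T2)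
    (o1 : T1) (o2 : T2) (w1 : set (nat -> T1)) (w2 : set (nat -> T2))
    (w1_end : is_end w1) (w2_end : is_end w2)
    (FUSF WUSF : probability (borel (config (DL o1 o2 w1 w2))) R)
    (FUSFP : is_FUSF FUSF) (WUSFP : is_WUSF WUSF)
    (A : set (borel (config (DL o1 o2 w1 w2)))) (mA : measurable A) :
  FUSF A = WUSF A.
Proof.
have q_ge2 : (2 <= q)%N := leq_trans r_ge2 le_rq.
have [es [et edge_ends]] := edge_orientation (DL o1 o2 w1 w2).
apply: (free_eq_wired edge_ends _ _ FUSFP WUSFP) mA.
- exact: (DL_finite_nbrs q_ge2 r_ge2 T1_tree T1_reg T2_tree T2_reg w1_end w2_end).
- exact: (DL_liouville q_ge2 r_ge2 T1_tree T1_reg T2_tree T2_reg w1_end w2_end edge_ends).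
Qed.
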